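(* Let $t_0$ be a labeled cotree with $k$ leaves, $n_v$ internal nodes, $n_=$ edges joining two internal nodes with equal decorations ($0$–$0$ or $1$–$1$), and $n_{\neq}$ edges joining two internal nodes with different decorations. Let $M_{t_0}(z)$ be the exponential generating function (by number of leaves of $t$) of tuples $(t;\ell_1,\dots,\ell_k)$ where $t$ is a labeled canonical cotree and $(\ell_1,\dots,\ell_k)$ is a $k$-tuple of distinct leaves of $t$ whose induced cotree is $t_0$. Then $$M_{t_0}=L'\,(\exp L)^{n_v}\,(L^\bullet)^k\,(L^{\mathrm{odd}})^{n_=}\,(L^{\mathrm{even}})^{n_{\neq}},$$ where $L^\bullet(z)=zL'(z)$.
   Context: A cotree is a rooted non-plane tree whose internal nodes have at least two children and each carry a decoration $0$ or $1$; it is labeled if its $n$ leaves are labeled $1,\dots,n$ (size $n$). A cotree is canonical if every child of a node decorated $0$ (resp. $1$) is a leaf or decorated $1$ (resp. $0$). Induced cotree: for a cotree $t$ and a $k$-tuple $I=(\ell_1,\dots,\ell_k)$ of distinct leaves, $t_I$ is the labeled cotree whose leaves are the $\ell_i$ (with $\ell_i$ labeled $i$) and whose internal nodes are the nodes of $t$ that are deepest common ancestors of at least two $\ell_i$, with ancestor relation and decorations inherited from $t$. $\mathcal L$ is the family of non-plane rooted trees whose internal nodes have at least two children, leaves labeled, size = number of leaves; $L(z)=\sum_n \ell_n z^n/n!$ is its exponential generating function and $L'$ its derivative. $L^{\mathrm{even}}(z)=\sum_{n\ge1}\frac{e_n}{(n-1)!}z^{n-1}$ and $L^{\mathrm{odd}}(z)=\sum_{n\ge1}\frac{o_n}{(n-1)!}z^{n-1}$,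 where $e_n$ (resp. $o_n$) is the number of trees of $\mathcal L$ with leaves labeled $1,\dots,n$ in which leaf $n$ is at even (resp. odd) distance from the root.
   Formalization: The theorem assumes k ≥ 2; for k = 1 (t_0 a single leaf) the formula is false: M_{t_0} = z + 2z² + 4z³ + …, while L'L^• = z + 2z² + 5z³ + …. *)

(* Defs.v *)
From HB Require Import structures.
From mathcomp Require Import all_boot all_order all_algebra.
From mathcomp Require Import finmap.
From mathcomp Require Import mathcomp_extra boolp classical_sets functions.
From mathcomp Require Import cardinality.

Set Implicit Arguments.
Unset Strict Implicit.
Unset Printing Implicit Defensive.

Import GRing.Theory.
Local Open Scope classical_set_scope.
Local Open Scope ring_scope.
Local Open Scope quotient_scope.

Record fps := Fps { coefs : nat -> rat }.

Lemma fpsP (f g : fps) : coefs f =1 coefs g -> f = g.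
Proof. by case: f g => [f] [g] /= /funext ->. Qed.

HB.instance Definition _ := gen_eqMixin fps.
HB.instance Definition _ := gen_choiceMixin fps.

Definition fps_zero := Fps (fun=> 0).
Definition fps_opp (f : fps) := Fps (fun n => - coefs f n).
Definition fps_add (f g : fps) := Fps (fun n => coefs f n + coefs g n).

Lemma fps_addA : associative fps_add.
Proof. by move=> f g h; apply: fpsP => n /=; rewrite addrA. Qed.
Lemma fps_addC : commutative fps_add.
Proof. by move=> f g; apply: fpsP => n /=; rewrite addrC. Qed.
Lemma fps_add0 : left_id fps_zero fps_add.
Proof. by move=> f; apply: fpsP => n /=; rewrite add0r. Qed.
Lemma fps_addN : left_inverse fps_zero fps_opp fps_add.
Proof. by move=> f; apply: fpsP => n /=; rewrite addNr. Qed.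

HB.instance Definition _ :=
  GRing.isZmodule.Build fps fps_addA fps_addC fps_add0 fps_addN.

Definition fps_one := Fps (fun n => (n == 0%N)%:R).
Definition fps_mul (f g : fps) :=
  Fps (fun n => \sum_(i < n.+1) coefs f i * coefs g (n - i)).

Lemma fps_mul_poly (f g : fps) N n : (n < N)%N ->
  coefs (fps_mul f g) n
  = (\poly_(i < N) coefs f i * \poly_(i < N) coefs g i)`_n.
Proof.
move=> nN; rewrite coefM; apply: eq_bigr => i _; rewrite !coef_poly.
by rewrite (leq_ltn_trans (leq_subr _ _) nN) (leq_ltn_trans _ nN) -1?ltnS.
Qed.

Lemma fps_mulC : commutative fps_mul.
Proof.
by move=> f g; apply: fpsP => n; rewrite !(fps_mul_poly _ _ (ltnSn n)) mulrC.
Qed.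
Lemma fps_mulA : associative fps_mul.
Proof.
move=> f g h; apply: fpsP => n.
set P := fun e : fps => \poly_(i < n.+1) coefs e i.
have PM e1 e2 i : (i < n.+1)%N -> (P (fps_mul e1 e2))`_i = (P e1 * P e2)`_i.
  by move=> lti; rewrite coef_poly lti (fps_mul_poly _ _ lti).
rewrite !(fps_mul_poly _ _ (ltnSn n)) -!/(P _).
transitivity (P f * (P g * P h))`_n.
  by rewrite !coefM; apply: eq_bigr => i _; rewrite PM // ltnS leq_subr.
by rewrite mulrA !coefM; apply: eq_bigr => i _; rewrite PM.
Qed.
Lemma fps_mul1 : left_id fps_one fps_mul.
Proof.
move=> f; apply: fpsP => n /=; rewrite big_ord_recl /= mul1r subn0.
by rewrite big1 ?addr0 // => i _; rewrite mul0r.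
Qed.
Lemma fps_mulD : left_distributive fps_mul fps_add.
Proof.
move=> f g h; apply: fpsP => n /=; rewrite -big_split /=.
by apply: eq_bigr => i _; rewrite mulrDl.
Qed.
Lemma fps_one_neq0 : fps_one != 0.
Proof. by apply/eqP => /(congr1 (fun f : fps => coefs f 0%N)). Qed.

HB.instance Definition _ := GRing.Zmodule_isComNzRing.Build fps
  fps_mulA fps_mulC fps_mul1 fps_mulD fps_one_neq0.

Definition fps_X : fps := Fps (fun n => (n == 1%N)%:R).
Definition fps_deriv (f : fps) : fps := Fps (fun n => coefs f n.+1 *+ n.+1).

(* The composition exp o f, for f with zero constant coefficient: the powers
   f ^+ j with j > n then do not contribute to the coefficient of order n. *)
Definition fps_exp (f : fps) : fps :=
  Fps (fun n => \sum_(j < n.+1) coefs (f ^+ j) n / (j`!)%:R).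

Definition egf (a : nat -> nat) : fps := Fps (fun n => (a n)%:R / (n`!)%:R).

(* Plane trees with internal nodes decorated in D and leaves labeled in nat.
   Undecorated trees are obtained with D = unit, cotrees with D = bool
   (false for the decoration 0 and true for the decoration 1). *)
Inductive ptree (D : Type) :=
  | Leaf of nat
  | Node of D & seq (ptree D).
Arguments Leaf {D}.

HB.instance Definition _ D := gen_eqMixin (ptree D).
HB.instance Definition _ D := gen_choiceMixin (ptree D).

(* Non-plane trees are plane trees up to reordering of the children. *)
Inductive reorder (D : Type) : ptree D -> ptree D -> Prop :=
  | reorder_refl t : reorder t t
  | reorder_sym t u : reorder t u -> reorder u t
  | reorder_trans t u v : reorder t u -> reorder u v -> reorder t v
  | reorder_perm d ts us : perm_eq ts us -> reorder (Node d ts) (Node d us)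
  | reorder_child d ts t u us : reorder t u ->
      reorder (Node d (ts ++ t :: us)) (Node d (ts ++ u :: us)).

Definition reorderb (D : Type) : rel (ptree D) := fun t u => `[< reorder t u >].

Lemma reorderb_refl D : reflexive (@reorderb D).
Proof. by move=> t; apply/asboolP; apply: reorder_refl. Qed.
Lemma reorderb_sym D : symmetric (@reorderb D).
Proof. by move=> t u; apply/asboolP/asboolP; apply: reorder_sym. Qed.
Lemma reorderb_trans D : transitive (@reorderb D).
Proof.
by move=> u t v /asboolP tu /asboolP uv; apply/asboolP; apply: reorder_trans uv.
Qed.

Canonical reorder_equiv D :=
  EquivRel (@reorderb D) (@reorderb_refl D) (@reorderb_sym D) (@reorderb_trans D).

Definition tree (D : Type) := {eq_quot (@reorder_equiv D)}.
HB.instance Definition _ D := Choice.on (tree D).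
HB.instance Definition _ D := EqQuotient.on (tree D).

Fixpoint leaves (D : Type) (t : ptree D) : seq nat :=
  match t with
  | Leaf a => [:: a]
  | Node _ ts => flatten (map (@leaves D) ts)
  end.

Fixpoint no_unary (D : Type) (t : ptree D) : bool :=
  match t with
  | Leaf _ => true
  | Node _ ts => (1 < size ts)%N && all (@no_unary D) ts
  end.

Definition labeled (D : Type) (n : nat) (t : ptree D) : bool :=
  no_unary t && perm_eq (leaves t) (iota 1 n).

Fixpoint leaf_dist (D : Type) (a : nat) (t : ptree D) (h : nat) : bool :=
  match t, h with
  | Leaf b, 0%N => b == a
  | Node _ ts, h'.+1 => has (fun u => leaf_dist a u h') ts
  | _, _ => false
  end.

Definition decorated (d : bool) (t : ptree bool) : bool :=
  if t is Node e _ then e == d else false.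

Fixpoint canonical (t : ptree bool) : bool :=
  match t with
  | Leaf _ => true
  | Node d ts => all (fun u => ~~ decorated d u) ts && all canonical ts
  end.

(* A node with children ts is the deepest common ancestor of at least two leaves
   of I: two leaves of I descend from it, but not both from the same child. *)
Definition is_dca (D : Type) (I : seq nat) (ts : seq (ptree D)) : bool :=
  has (fun a => has (fun b =>
    [&& a != b, has (fun u => a \in leaves u) ts,
        has (fun u => b \in leaves u) ts
      & ~~ has (fun u => (a \in leaves u) && (b \in leaves u)) ts]) I) I.

(* Among the nodes of t, keep only the leaves in I (the leaf I_i gets label i,
   starting from 1) and the deepest common ancestors of at least two leaves of I;
   a node that is not kept is replaced by what is kept below it.  The result is
   a forest, which is a single tree if I is a nonempty sequence of leaves of t. *)
Fixpoint restrict (D : Type) (I : seq nat) (t : ptree D) : seq (ptree D) :=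
  match t with
  | Leaf a => if a \in I then [:: Leaf (index a I).+1] else [::]
  | Node d ts =>
      let us := flatten (map (@restrict D I) ts) in
      if is_dca I ts then [:: Node d us] else us
  end.

Definition induces (D : Type) (t : ptree D) (I : seq nat) (t0 : ptree D) : Prop :=
  exists2 u, restrict I t = [:: u] & reorder u t0.

Fixpoint n_internal (D : Type) (t : ptree D) : nat :=
  match t with
  | Leaf _ => 0%N
  | Node _ ts => (sumn (map (@n_internal D) ts)).+1
  end.

Fixpoint n_eq_edges (t : ptree bool) : nat :=
  match t with
  | Leaf _ => 0%N
  | Node d ts => (count (decorated d) ts + sumn (map n_eq_edges ts))%N
  end.

Fixpoint n_neq_edges (t : ptree bool) : nat :=
  match t with
  | Leaf _ => 0%N
  | Node d ts => (count (decorated (~~ d)) ts + sumn (map n_neq_edges ts))%N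
  end.

(* fset_set A is empty if A is infinite; finiteness of the sets counted below
   is finite_count_trees and finite_marked. *)
Definition card_set (T : choiceType) (A : set T) : nat := #|` fset_set A|.

Definition count_trees (D : Type) (P : ptree D -> Prop) (n : nat) : nat :=
  card_set [set \pi_(tree D) t | t in [set t | labeled n t /\ P t]].

Definition L : fps := egf (count_trees (fun _ : ptree unit => True)).

Definition n_even (n : nat) : nat :=
  count_trees (fun t : ptree unit => exists2 h, leaf_dist n t h & ~~ odd h) n.
Definition n_odd (n : nat) : nat :=
  count_trees (fun t : ptree unit => exists2 h, leaf_dist n t h & odd h) n.

Definition L_even : fps := egf (fun n => n_even n.+1).
Definition L_odd : fps := egf (fun n => n_odd n.+1).
Definition L_bullet : fps := fps_X * fps_deriv L.

Definition marked (k : nat) (t0 : ptree bool) (n : nat) :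
    set (ptree bool * k.-tuple nat) :=
  [set p : ptree bool * k.-tuple nat |
         [/\ labeled n p.1, canonical p.1, uniq p.2,
               {subset p.2 <= leaves p.1} & induces p.1 p.2 t0]].
Arguments marked : clear implicits.

Definition M (k : nat) (t0 : ptree bool) : fps :=
  egf (fun n =>
    card_set [set (\pi_(tree bool) p.1, p.2) | p in marked k t0 n]).

Lemma finite_seqs (T : eqType) (A : set T) (m : nat) : finite_set A ->
  finite_set [set s : seq T | (size s <= m)%N /\ forall x, x \in s -> A x].
Proof.
move=> finA; elim: m => [|m IHm].
  by apply: (@sub_finite_set _ _ [set [::]]) => [[|x s] []|] //; apply: finite_set1.
set B := [set s | _] in IHm.
apply: (@sub_finite_set _ _ ([set [::]] `|` [set x :: s | x in A & s in B])).
  move=> [|x s] [/= szs As]; first by left.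
  right; exists x; first by apply: As; rewrite mem_head.
  by exists s => //; split=> // y sy; apply: As; rewrite in_cons sy orbT.
by rewrite finite_setU; split; [apply: finite_set1|apply: finite_image2].
Qed.

Lemma size_leaves_gt0 (D : Type) (t : ptree D) :
  no_unary t -> (0 < size (leaves t))%N.
Proof.
move: t; fix IH 1; case=> [//|d [//|t ts]] /= /andP[_ /andP[/IH t_gt0 _]].
by rewrite size_cat addn_gt0 t_gt0.
Qed.

Lemma finite_bounded (D : finType) (N m : nat) :
  finite_set [set t : ptree D |
    [/\ no_unary t, (size (leaves t) <= m)%N & {subset leaves t <= iota 1 N}]].
Proof.
elim: m => [|m IHm].
  apply: (@sub_finite_set _ _ set0) => [t [/size_leaves_gt0]|]; last exact: finite_set0.
  by rewrite leqn0 => /lt0n_neq0/negPf->.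
set B := [set t | _] in IHm.
apply: (@sub_finite_set _ _ ([set Leaf a | a in `I_N.+1] `|`
    [set Node d ts | d in [set: D] &
       ts in [set s | (size s <= m.+1)%N /\ forall x, x \in s -> B x]])).
  move=> [a|d ts] [/= nu sz sub].
    left; exists a => //=; have := sub a; rewrite mem_seq1 eqxx mem_iota.
    by move=> /(_ isT) /andP[_]; rewrite add1n.
  right; exists d => //; exists ts => //.
  have {nu}[sz2 nu] := andP nu.
  have szts (s : seq (ptree D)) : all (@no_unary D) s ->
      (size s <= size (flatten (map (@leaves D) s)))%N.
    elim: s => //= t s IHs /andP[/size_leaves_gt0 t0 /IHs s_le].
    by rewrite size_cat -add1n leq_add.
  split; first exact: leq_trans (szts _ nu) sz.
  move=> t tts; case/splitPr: tts sz2 nu sz sub => s1 s2 sz2 nu sz sub.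
  move: nu; rewrite all_cat /= => /and3P[nu1 nut nu2].
  move: sz sub sz2; rewrite map_cat flatten_cat /= !size_cat /= => sz sub sz2.
  split=> //; last first.
    by move=> a ta; apply: sub; rewrite !mem_cat ta orbT.
  have := leq_add (szts _ nu1) (szts _ nu2).
  rewrite addnS ltnS in sz2 => /(leq_trans sz2) s12.
  by rewrite -ltnS (leq_trans _ sz) // addnCA -addn1 leq_add2l.
rewrite finite_setU; split; first exact/finite_image/finite_II.
by apply: finite_image2; [exact: finite_finset|exact: finite_seqs].
Qed.

Lemma finite_labeled (D : finType) (n : nat) :
  finite_set [set t : ptree D | labeled n t].
Proof.
apply: sub_finite_set (@finite_bounded D n n) => t /andP[nu tn]; split=> //.
  by rewrite (perm_size tn) size_iota.
by move=> a; rewrite (perm_mem tn).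
Qed.

Lemma finite_count_trees (D : finType) (P : ptree D -> Prop) (n : nat) :
  finite_set [set \pi_(tree D) t | t in [set t | labeled n t /\ P t]].
Proof.
by apply/finite_image/(sub_finite_set _ (@finite_labeled D n)) => t [].
Qed.

Lemma finite_marked (k : nat) (t0 : ptree bool) (n : nat) :
  finite_set [set (\pi_(tree bool) p.1, p.2) | p in marked k t0 n].
Proof.
apply: finite_image.
have finI : finite_set [set I : k.-tuple nat | {subset I <= iota 1 n}].
  pose f (J : k.-tuple 'I_n.+1) : k.-tuple nat := map_tuple (@nat_of_ord _) J.
  apply: (@sub_finite_set _ _ [set f J | J in [set: k.-tuple 'I_n.+1]]).
    move=> I In; exists (map_tuple (@inord n) I) => //; apply: val_inj => /=.
    rewrite -map_comp map_id_in // => a /In; rewrite mem_iota => /andP[_ an].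
    by rewrite /= inordK // -add1n.
  by apply/finite_image/finite_finset.
apply: sub_finite_set (finite_setX (@finite_labeled bool n) finI).
move=> [t I] [/= tn _ _ sub _]; split=> //= a /sub.
by have /andP[_ /perm_mem->] := tn.
Qed.

(* Main.v *)
(* Weight a plane tree by the product of 1/c! over its internal nodes, c being the
   number of children.  A non-plane tree with distinct leaf labels has total weight 1
   over its plane representatives, so counting non-plane trees means summing weights
   of plane trees; there the labels can be dropped, exponential generating functions
   of labelled objects becoming ordinary generating functions of plane trees whose k
   chosen leaves are marked.  The factor 1/c! also makes the series of a forest
   having one tree in each of r disjoint classes A_i, the others being unmarked,
   equal to A_1 ... A_r exp L.

   Let P_d(r) be the series of the canonical cotrees inducing r that may hang below
   a node decorated d.  Either the root is the root of r, or a single child of the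
   root contains all the marks: P_d(r) = top_d(r) + P_{~d}(r) (exp L - 1).  As
   L_even = 1 + L_odd (exp L - 1) and L_odd = L_even (exp L - 1), this gives
   P_d(r) = top_d(r) L_even + top_{~d}(r) L_odd, and L' = L_even + L_odd. *)
Require Import Defs.
From mathcomp Require Import all_boot all_order all_algebra.
From mathcomp Require Import finmap.
From mathcomp Require Import mathcomp_extra boolp classical_sets functions.
From mathcomp Require Import cardinality ring.

Set Implicit Arguments.
Unset Strict Implicit.
Unset Printing Implicit Defensive.

Import GRing.Theory Num.Theory.
Local Open Scope classical_set_scope.
Local Open Scope ring_scope.
Local Open Scope quotient_scope.

(** * Weighted sums over finite sets and generating functions *)

(* Zero if A is infinite, as [fset_set A] is then empty. *)
Definition wsum (T : choiceType) (w : T -> rat) (A : set T) : rat :=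
  \sum_(x <- fset_set A) w x.

Lemma finite_seq_of (T : choiceType) (A : set T) (s : seq T) :
  (forall x, A x <-> x \in s) -> finite_set A.
Proof.
by move=> sA; apply/finite_seqP; exists s; apply/seteqP; split=> y /sA.
Qed.

Lemma wsum_seq (T : choiceType) (w : T -> rat) (A : set T) (s : seq T) :
  uniq s -> (forall x, A x <-> x \in s) -> wsum w A = \sum_(x <- s) w x.
Proof.
move=> us sA; apply: perm_big; apply: uniq_perm; rewrite ?fset_uniq // => x.
have finA := finite_seq_of sA.
by rewrite in_fset_set //; apply/idP/idP => [/set_mem/sA|/sA/mem_set].
Qed.

Lemma in_fsetE (T : choiceType) (A : set T) : finite_set A ->
  forall x, A x <-> x \in fset_set A.
Proof.
by move=> fA x; rewrite in_fset_set //; split=> [/mem_set|/set_mem].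
Qed.

Lemma eq_wsum (T : choiceType) (w w' : T -> rat) (A : set T) : finite_set A ->
  (forall x, A x -> w x = w' x) -> wsum w A = wsum w' A.
Proof.
move=> fA ww'; rewrite /wsum big_seq [RHS]big_seq.
by apply: eq_bigr => x /(in_fsetE fA)/ww'.
Qed.

Lemma wsum_cst (T : choiceType) (c : rat) (A : set T) :
  wsum (fun=> c) A = c *+ card_set A.
Proof. by rewrite /wsum big_const_seq count_predT iter_addr addr0. Qed.

Lemma wsumZ (T : choiceType) (c : rat) (w : T -> rat) (A : set T) :
  wsum (fun x => c * w x) A = c * wsum w A.
Proof. by rewrite /wsum mulr_sumr. Qed.

Lemma wsum0 (T : choiceType) (w : T -> rat) : wsum w set0 = 0.
Proof. by rewrite (@wsum_seq _ _ _ [::]) ?big_nil. Qed.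

Lemma wsum1 (T : choiceType) (w : T -> rat) x : wsum w [set x] = w x.
Proof.
rewrite (@wsum_seq _ _ _ [:: x]) ?big_seq1 // => y.
by rewrite inE; split=> [->|/eqP->].
Qed.

Lemma wsumU (T : choiceType) (w : T -> rat) (A B : set T) :
  finite_set A -> finite_set B -> (forall x, A x -> ~ B x) ->
  wsum w (A `|` B) = wsum w A + wsum w B.
Proof.
move=> fA fB dAB; rewrite -big_cat; apply: wsum_seq => [|x].
  rewrite cat_uniq !fset_uniq andbT /=; apply/hasPn => x /(in_fsetE fB) Bx.
  by apply/negP => /(in_fsetE fA) /dAB.
rewrite mem_cat; split=> [[/(in_fsetE fA)->//|/(in_fsetE fB)->]|].
  by rewrite orbT.
by move=> /orP[/(in_fsetE fA)|/(in_fsetE fB)]; [left|right].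
Qed.

Lemma wsum_inj (T T' : choiceType) (w : T -> rat) (w' : T' -> rat)
    (f : T -> T') (A : set T) (B : set T') : finite_set A ->
  (forall x y, A x -> A y -> f x = f y -> x = y) ->
  (forall y, B y <-> exists2 x, A x & f x = y) ->
  (forall x, A x -> w' (f x) = w x) ->
  wsum w' B = wsum w A.
Proof.
move=> fA finj BA ww'; rewrite (@wsum_seq _ _ _ (map f (fset_set A))).
- by rewrite big_map; apply: eq_wsum.
- rewrite map_inj_in_uniq ?fset_uniq // => x y.
  by move=> /(in_fsetE fA) + /(in_fsetE fA); apply: finj.
- move=> y; rewrite BA; split=> [[x /(in_fsetE fA) Ax <-]|].
    exact: map_f.
  by move=> /mapP[x /(in_fsetE fA) Ax ->]; exists x.
Qed.

Lemma wsum_pair (T T' : choiceType) (A : set T) (B : T -> set T')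
    (w : T * T' -> rat) : finite_set A -> (forall x, A x -> finite_set (B x)) ->
  wsum w [set p | A p.1 /\ B p.1 p.2] =
  wsum (fun x => wsum (fun y => w (x, y)) (B x)) A.
Proof.
move=> fA fB; rewrite {2}/wsum.
rewrite (@wsum_seq _ _ _ [seq (x, y) | x <- fset_set A, y <- fset_set (B x)]).
- by rewrite big_allpairs_dep.
- apply: allpairs_uniq_dep; first exact: fset_uniq.
    by move=> x _; apply: fset_uniq.
  by move=> [x y] [x' y'] _ _ /= [-> ->].
move=> [x y] /=; split=> [[Ax Bxy]|].
  by apply/allpairsPdep; exists x, y; split=> //;
    [exact/(in_fsetE fA)|exact/(in_fsetE (fB _ Ax))].
case/allpairsPdep=> x' [y' [/(in_fsetE fA) Ax Bxy [-> ->]]].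
by split=> //; exact/(in_fsetE (fB _ Ax)).
Qed.

Lemma wsum_fibers (T : choiceType) (w : T -> rat) (A : set T) (f : T -> nat) m :
  finite_set A -> (forall x, A x -> (f x < m)%N) ->
  wsum w A = \sum_(i < m) wsum w [set x | A x /\ f x = i].
Proof.
move=> fA fm; case: m fm => [|m] fm.
  rewrite big_ord0 (_ : A = set0) ?wsum0 //.
  by apply/seteqP; split=> // x /fm.
rewrite {1}/wsum big_seq (partition_big (fun x => inord (f x) : 'I_m.+1) predT) //=.
apply: eq_bigr => i _; rewrite (@wsum_seq _ _ _ [seq x <- fset_set A | f x == i]).
- rewrite big_filter [RHS]big_seq_cond; apply: eq_bigl => x.
  case: (boolP (x \in _)) => //= /(in_fsetE fA)/fm xm.
  by rewrite -val_eqE /= inordK.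
- exact/filter_uniq/fset_uniq.
- move=> x; rewrite mem_filter /=; split=> [[/(in_fsetE fA)-> ->]|].
    by rewrite eqxx.
  by move=> /andP[/eqP-> /(in_fsetE fA)].
Qed.

(** Each fibre of [f] has total weight 1, so summing the weights counts the fibres. This is how a
    count of non-plane trees becomes a weighted sum over plane trees. *)
Lemma wsum_card (T T' : choiceType) (w : T -> rat) (f : T -> T') (A : set T) :
  finite_set A ->
  (forall x, A x -> wsum w [set y | A y /\ f y = f x] = 1) ->
  (card_set [set f x | x in A])%:R = wsum w A.
Proof.
move=> fA w1; rewrite -wsum_cst.
have fB : finite_set [set f x | x in A] by exact: finite_image.
have -> : wsum (fun=> 1) [set f x | x in A] =
    wsum (fun z => wsum w [set y | A y /\ f y = z]) [set f x | x in A].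
  by apply: eq_wsum => // _ [x Ax <-]; rewrite w1.
(* The double sum over a value and its fibre is a single sum over the graph of [f], which projects
   bijectively onto [A]. *)
rewrite -(@wsum_pair _ _ [set f x | x in A] (fun z => [set y | A y /\ f y = z])
  (fun p => w p.2)) //.
  apply: (@wsum_inj _ _ _ _ (fun x => (f x, x))) => //.
    by move=> x y _ _ [_ ->].
  move=> [z x] /=; split=> [[[y Ay yz] [Ax xz]]|[y Ay [<- <-]]].
    by exists x; rewrite ?xz.
  by split=> //; exists y.
by move=> z _; apply: sub_finite_set fA => y [].
Qed.

(** * Generating functions of weighted classes graded by size *)

Section GeneratingFunction.
Variables (T : choiceType) (sz : T -> nat) (w : T -> rat).
Implicit Types A B : set T.

Definition gf A : fps := Fps (fun n => wsum w [set x | A x /\ sz x = n]).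
(** Since [wsum] is 0 on an infinite set, a coefficient of [gf] has its intended meaning only under
    this local finiteness. *)
Definition lfin A := forall n, finite_set [set x | A x /\ sz x = n].

Lemma lfin_sub A B : A `<=` B -> lfin B -> lfin A.
Proof. by move=> AB fB n; apply: sub_finite_set (fB n) => x [/AB]. Qed.

Lemma lfin_le A n : lfin A -> finite_set [set x | A x /\ (sz x <= n)%N].
Proof.
move=> fA; apply: (@sub_finite_set _ _
    (\bigcup_(i in `I_n.+1) [set x | A x /\ sz x = i])).
  by move=> x [Ax xn]; exists (sz x).
by apply: bigcup_finite => [|i _]; [exact: finite_II|exact: fA].
Qed.

Lemma gfU A B : lfin A -> lfin B -> (forall x, A x -> ~ B x) ->
  gf (A `|` B) = gf A + gf B.
Proof.
move=> fA fB dAB; apply: fpsP => n /=; rewrite -wsumU //.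
  congr wsum; apply/seteqP; split=> x.
    by case=> -[]; [left|right].
  by move=> [] [? ?]; split=> //; [left|right].
by move=> x [/dAB nB _] [].
Qed.

End GeneratingFunction.

Lemma gf_inj (T T' : choiceType) (sz : T -> nat) (sz' : T' -> nat)
    (w : T -> rat) (w' : T' -> rat) (f : T -> T') (A : set T) (B : set T') :
  lfin sz A ->
  (forall x y, A x -> A y -> f x = f y -> x = y) ->
  (forall y, B y <-> exists2 x, A x & f x = y) ->
  (forall x, A x -> sz' (f x) = sz x /\ w' (f x) = w x) ->
  gf sz' w' B = gf sz w A.
Proof.
move=> fA finj BA fw; apply: fpsP => n /=; apply: (@wsum_inj _ _ _ _ f) => //.
- by move=> x y [Ax _] [Ay _]; apply: finj.
- move=> y; split=> [[/BA[x Ax <-]]|[x [Ax xn] <-]].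
    by have [-> _] := fw _ Ax; exists x.
  by split; [apply/BA; exists x|have [-> _] := fw _ Ax].
- by move=> x [/fw[]].
Qed.

Lemma finite_pairs (T T' : choiceType) (sz : T -> nat) (sz' : T' -> nat)
    (A : set T) (B : set T') :
  lfin sz A -> lfin sz' B ->
  lfin (fun p : T * T' => sz p.1 + sz' p.2)%N [set p | A p.1 /\ B p.2].
Proof.
move=> fA fB n.
apply: sub_finite_set (finite_setX (lfin_le n fA) (lfin_le n fB)).
by move=> [x y] /= [[Ax By] xyn]; split; split=> //=; rewrite -xyn ?leq_addr ?leq_addl.
Qed.

Lemma gfM (T T' : choiceType) (sz : T -> nat) (sz' : T' -> nat)
    (w : T -> rat) (w' : T' -> rat) (A : set T) (B : set T') :
  lfin sz A -> lfin sz' B ->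
  gf (fun p : T * T' => sz p.1 + sz' p.2)%N (fun p => w p.1 * w' p.2)
     [set p | A p.1 /\ B p.2]
  = gf sz w A * gf sz' w' B.
Proof.
move=> fA fB; apply: fpsP => n /=.
rewrite (@wsum_fibers _ _ _ (fun p => sz p.1) n.+1); last 2 first.
- exact: (finite_pairs fA fB).
- by move=> [x y] [_ /= <-]; rewrite ltnS leq_addr.
apply: eq_bigr => i _.
transitivity (wsum (fun p : T * T' => w p.1 * w' p.2)
    [set p | [set x | A x /\ sz x = i] p.1 /\ [set y | B y /\ sz' y = n - i]%N p.2]).
  congr wsum; apply/seteqP; split=> -[x y] /=.
    by move=> [[[Ax By] xyn] xi]; do 2 split=> //; rewrite -xi -xyn addKn.
  by move=> [[Ax ->] [By ->]]; split=> //; split=> //; rewrite subnKC // -ltnS.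
rewrite (@wsum_pair _ _ [set x | A x /\ sz x = i]
  (fun=> [set y | B y /\ sz' y = n - i]%N)) //=.
rewrite mulrC -wsumZ; apply: eq_wsum => // x _; by rewrite wsumZ mulrC.
Qed.

(** * Weighted plane forests *)

(** The generated induction principle gives nothing about the trees nested in the list of children;
    this one supplies the hypothesis for each child. *)
Lemma ptree_ind_mem (D : Type) (P : ptree D -> Prop) :
  (forall a, P (Leaf a)) ->
  (forall d ts, (forall t, t \in ts -> P t) -> P (Node d ts)) ->
  forall t, P t.
Proof.
move=> PL PN; fix IH 1; case=> [a|d ts]; first exact: PL.
(* [IH] is cleared so that the trivial case is not closed by an unguarded recursive call. *)
apply: PN; elim: ts => [|t ts IHts] u; first by clear IH.
rewrite inE.
by case/predU1P => [->|]; [apply: IH|apply: IHts].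
Qed.

Section Forests.
Variable D : Type.
Implicit Types (t u : ptree D) (ts us : seq (ptree D)).

(** The recursive calls go through [map], where they are visibly structural, rather than through the
    body of the big operator. *)
Fixpoint weight t : rat :=
  match t with
  | Leaf _ => 1
  | Node _ ts => (\prod_(x <- map weight ts) x) / (size ts)`!%:R
  end.

Definition n_leaves t := size (leaves t).
Definition fleaves ts := flatten (map (@leaves D) ts).
Definition fsize ts := size (fleaves ts).
Definition fprod ts : rat := \prod_(t <- ts) weight t.
(** The factorial is the one that a parent of the forest would bring, so that grafting a root
    changes neither size nor weight. *)
Definition fweight ts : rat := fprod ts / (size ts)`!%:R.

Lemma weight_node d ts : weight (Node d ts) = fweight ts.
Proof. by rewrite /= big_map. Qed.

Lemma fleaves_cat ts us : fleaves (ts ++ us) = fleaves ts ++ fleaves us.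
Proof. by rewrite /fleaves map_cat flatten_cat. Qed.

Lemma mem_fleaves a ts : (a \in fleaves ts) = has (fun t => a \in leaves t) ts.
Proof.
apply/flattenP/hasP => [[_ /mapP[t tts ->] at_]|[t tts at_]]; first by exists t.
by exists (leaves t) => //; apply: map_f.
Qed.

Lemma perm_fleaves ts us : perm_eq ts us -> perm_eq (fleaves ts) (fleaves us).
Proof. by move=> tu; apply/perm_flatten/perm_map. Qed.

Lemma fsize_cat ts us : fsize (ts ++ us) = (fsize ts + fsize us)%N.
Proof. by rewrite /fsize fleaves_cat size_cat. Qed.

Definition tgf : set (ptree D) -> fps := gf n_leaves weight.
Definition fgf : set (seq (ptree D)) -> fps := gf fsize fweight.

Definition ins (A : set (ptree D)) (F : set (seq (ptree D))) :
    set (seq (ptree D)) :=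
  [set ts | exists ts1 t ts2, [/\ ts = ts1 ++ t :: ts2, A t & F (ts1 ++ ts2)]].

Lemma ins_at ts i t : fsize (take i ts ++ t :: drop i ts) = (n_leaves t + fsize ts)%N
  /\ fprod (take i ts ++ t :: drop i ts) = weight t * fprod ts.
Proof.
split; first by rewrite -{3}(cat_take_drop i ts) -cat1s !fsize_cat addnCA /fsize
  /fleaves /= cats0.
by rewrite /fprod -{3}(cat_take_drop i ts) !big_cat big_cons /= mulrCA.
Qed.

Lemma insE A F ts : ins A F ts <->
  exists2 x : (ptree D * seq (ptree D)) * nat,
    [/\ A x.1.1, F x.1.2 & (x.2 < (size x.1.2).+1)%N] &
    take x.2 x.1.2 ++ x.1.1 :: drop x.2 x.1.2 = ts.
Proof.
split=> [[ts1 [t [ts2 [-> At Fts]]]]|[[[t us] i] [/= At Fus ile <-]]].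
  exists ((t, ts1 ++ ts2), size ts1) => /=.
    by split=> //; rewrite ltnS size_cat leq_addr.
  by rewrite take_size_cat // drop_size_cat.
by exists (take i us), t, (drop i us); rewrite cat_take_drop.
Qed.

Lemma lfin_ins A F : lfin n_leaves A -> lfin fsize F -> lfin fsize (ins A F).
Proof.
move=> fA fF n.
apply: (@sub_finite_set _ _ (\bigcup_(p in [set p : ptree D * seq (ptree D) |
    (A p.1 /\ F p.2) /\ (n_leaves p.1 + fsize p.2)%N = n])
    [set take i p.2 ++ p.1 :: drop i p.2 | i in `I_(size p.2).+1])).
  move=> ts [/insE[[[t us] i] [/= At Fus ile <-]]].
  by rewrite (ins_at _ _ _).1 => tn; exists (t, us) => //=; exists i.
apply: bigcup_finite => [|p _]; first exact: (finite_pairs fA fF).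
exact/finite_image/finite_II.
Qed.

(* A forest in [ins A F] has a unique tree in A; removing it yields a forest in F,
   in which it can be inserted at [(size ts).+1] places: this factor turns
   [1 / (size ts)`!] into [1 / (size ts).+1`!]. *)
Lemma fgf_ins A F : lfin n_leaves A -> lfin fsize F ->
  (forall ts t, F ts -> t \in ts -> ~ A t) ->
  fgf (ins A F) = tgf A * fgf F.
Proof.
move=> fA fF dAF; rewrite -gfM //; apply: fpsP => n /=.
pose P := [set p : ptree D * seq (ptree D) |
    (A p.1 /\ F p.2) /\ (n_leaves p.1 + fsize p.2)%N = n].
have fP : finite_set P := finite_pairs fA fF n.
pose ws (p : ptree D * seq (ptree D)) : rat :=
  weight p.1 * fprod p.2 / (size p.2).+1`!%:R.
transitivity (wsum (fun x : (ptree D * seq (ptree D)) * nat => ws x.1)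
    [set x | P x.1 /\ `I_(size x.1.2).+1 x.2]); last first.
  rewrite (@wsum_pair _ _ P (fun p => `I_(size p.2).+1)) //.
  apply: eq_wsum => // -[t ts] _ /=; rewrite wsum_cst /card_set.
  rewrite (card_fset_set (card_eqxx _)) -mulr_natr /ws /fweight /= factS natrM.
  by field; rewrite pnatr_eq0 -lt0n fact_gt0 nat1r pnatr_eq0.
(* The place of insertion is recovered as that of the first tree in [A], which makes insertion
   injective. *)
have find_at t ts i : A t -> F ts -> (i <= size ts)%N ->
    find (fun x => `[< A x >]) (take i ts ++ t :: drop i ts) = i.
  move=> At Fts ile; rewrite find_cat /= asboolT //= addn0 size_takel //.
  rewrite ifN //; apply/hasPn => x /mem_take xts.
  by apply/asboolPn; apply: dAF xts.
apply: (@wsum_inj _ _ _ _ (fun x => take x.2 x.1.2 ++ x.1.1 :: drop x.2 x.1.2)).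
- exact: (@finite_setXR _ _ P (fun p => `I_(size p.2).+1)).
- move=> [[t ts] i] [[u us] j] /= [[[/= At Fts] _]]; rewrite ltnS => ile.
  move=> [[[/= Au Fus] _]]; rewrite ltnS => jle tu.
  have ij : i = j by rewrite -(find_at t ts i) // tu find_at.
  subst j; move/eqP: tu; rewrite eqseq_cat ?size_takel // eqseq_cons.
  move=> /and3P[/eqP tk /eqP -> /eqP dr].
  by rewrite -(cat_take_drop i ts) tk dr cat_take_drop.
- move=> ts; split=> [[/insE[[[t us] i] [/= At Fus ile <-]]]|].
    by rewrite (ins_at _ _ _).1 => tn; exists ((t, us), i).
  move=> [[[t us] i] /= [[[At Fus] tn] ile] <-]; split.
    by apply/insE; exists ((t, us), i).
  by rewrite (ins_at _ _ _).1.
- move=> [[t ts] i] /= [[[/= At Fts] _]]; rewrite ltnS => ile.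
  rewrite /fweight (ins_at _ _ _).2 /ws /= size_cat /= size_takel // size_drop.
  by rewrite addnS subnKC.
Qed.

(** * Forests of trees from a class, and the exponential *)

Definition forests (U : set (ptree D)) : set (seq (ptree D)) :=
  [set ts : seq (ptree D) | forall t, t \in ts -> U t].

(** Each tree has a leaf, so a forest with [n] leaves has at most [n] trees. This is why the
    truncated sum in [fps_exp] is exact for forests. *)
Lemma size_fsize ts : (forall t, t \in ts -> (0 < n_leaves t)%N) ->
  (size ts <= fsize ts)%N.
Proof.
elim: ts => //= t ts IH tsP; rewrite -cat1s fsize_cat -add1n leq_add //.
  by rewrite /fsize /fleaves /= cats0 tsP ?mem_head.
by apply: IH => u uts; apply: tsP; rewrite inE uts orbT.
Qed.

Lemma lfin_forests U : (forall t, U t -> (0 < n_leaves t)%N) ->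
  lfin n_leaves U -> lfin fsize (forests U).
Proof.
move=> U0 fU n; apply: sub_finite_set (finite_seqs n (lfin_le n fU)).
move=> ts [Uts <-]; split; first by apply: size_fsize => t /Uts/U0.
move=> t tts; split; first exact: Uts.
by case/splitPr: tts => s1 s2; rewrite -cat1s !fsize_cat addnCA /fsize /fleaves
  /= cats0 leq_addr.
Qed.

(** Without the factorial in the weight, a forest of [j] trees is a word of length [j]; removing its
    first tree gives the recursion for powers. *)
Lemma gf_forests_size U j : (forall t, U t -> (0 < n_leaves t)%N) ->
  lfin n_leaves U ->
  gf fsize fprod [set ts : seq (ptree D) | forests U ts /\ size ts = j] = tgf U ^+ j.
Proof.
move=> U0 fU; elim: j => [|j IH].
  rewrite expr0; apply: fpsP => n /=; case: eqVneq => [->|n0].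
    rewrite (_ : [set x | _] = [set [::]]) ?wsum1 /fprod ?big_nil //.
    by apply/seteqP; split=> [[|x ts] [[]]|_ ->].
  rewrite (_ : [set x | _] = set0) ?wsum0 //; apply/seteqP; split=> // ts.
  by move=> [[_ /size0nil ->]] /esym/eqP; rewrite (negPf n0).
have fF : lfin fsize [set ts : seq (ptree D) | forests U ts /\ size ts = j].
  by apply: lfin_sub (lfin_forests U0 fU) => ts [].
rewrite exprS -IH -gfM //.
apply: (@gf_inj _ _ _ _ _ _ (fun p => p.1 :: p.2)).
- exact: finite_pairs.
- by move=> [t ts] [u us] _ _ /= [-> ->].
- move=> [|t ts]; first by split=> [[] //|[[u us] //]].
  split.
    move=> [Uts [sz]]; exists (t, ts) => //=; split.
      by apply: Uts; rewrite mem_head.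
    by split=> // u uts; apply: Uts; rewrite inE uts orbT.
  move=> [[u us] /= [Uu [Uus sz]] [<- <-]]; split; last by rewrite /= sz.
  by move=> v; rewrite inE => /predU1P[->//|/Uus].
- move=> [t ts] _ /=; rewrite -cat1s fsize_cat /fprod big_cons.
  by rewrite {1}/fsize /fleaves /= cats0.
Qed.

Lemma fgf_forests U : (forall t, U t -> (0 < n_leaves t)%N) ->
  lfin n_leaves U -> fgf (forests U) = fps_exp (tgf U).
Proof.
move=> U0 fU; apply: fpsP => n /=.
rewrite (@wsum_fibers _ _ _ size n.+1); last 2 first.
- exact: lfin_forests.
- by move=> ts [Uts <-]; rewrite ltnS; apply: size_fsize => t /Uts/U0.
apply: eq_bigr => j _; rewrite -gf_forests_size //= mulrC -wsumZ.
rewrite (_ : [set x | _] = [set x | (forests U x /\ size x = j) /\ fsize x = n]).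
  apply: eq_wsum => [|ts [[_ tsj] _]]; last by rewrite /fweight tsj mulrC.
  by apply: sub_finite_set (lfin_forests U0 fU n) => ts [[]].
by apply/seteqP; split=> ts [[]].
Qed.

Lemma lfin_node d F : lfin fsize F -> lfin n_leaves [set Node d ts | ts in F].
Proof.
move=> fF n; apply: sub_finite_set (finite_image (Node d) (fF n)).
by move=> _ [[ts Fts <-]] tn; exists ts.
Qed.

Lemma tgf_node d F : lfin fsize F -> tgf [set Node d ts | ts in F] = fgf F.
Proof.
move=> fF; apply: (@gf_inj _ _ _ _ _ _ (Node d)) => //.
  by move=> ts us _ _ [].
by move=> ts _; rewrite weight_node.
Qed.

Lemma fgf_nil : fgf [set [::]] = 1.
Proof.
apply: fpsP => n /=; case: eqVneq => [->|n0].
  rewrite (_ : [set x | _] = [set [::]]) ?wsum1 /fweight /fprod ?big_nil ?divr1 //.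
  by apply/seteqP; split=> [ts []|_ ->].
rewrite (_ : [set x | _] = set0) ?wsum0 //; apply/seteqP; split=> // ts.
by move=> [-> /esym/eqP]; rewrite (negPf n0).
Qed.

Lemma tgf_leaf a : tgf [set Leaf a] = fps_X.
Proof.
apply: fpsP => n /=; case: eqVneq => [->|n1].
  rewrite (_ : [set x | _] = [set Leaf a]) ?wsum1 //.
  by apply/seteqP; split=> [t []|_ ->].
rewrite (_ : [set x | _] = set0) ?wsum0 //; apply/seteqP; split=> // t.
by move=> [-> /esym/eqP]; rewrite (negPf n1).
Qed.

Lemma lfin_leaf a : lfin n_leaves [set Leaf a].
Proof. by move=> n; apply: sub_finite_set (finite_set1 (Leaf a)) => t []. Qed.

(** By [fgf_ins], one child in [A] and the others in [U] give [tgf A] times the exponential. The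
    forests reduced to one tree of [A], of series [tgf A], are then removed. *)
Lemma tgf_path d A U : (forall t, U t -> (0 < n_leaves t)%N) ->
  lfin n_leaves U -> lfin n_leaves A -> (forall t, A t -> ~ U t) ->
  tgf [set Node d ts | ts in [set ts | ins A (forests U) ts /\ (1 < size ts)%N]]
  = tgf A * (fps_exp (tgf U) - 1).
Proof.
move=> U0 fU fA dAU; set F := [set ts | _].
have fI : lfin fsize (ins A (forests U)) := lfin_ins fA (lfin_forests U0 fU).
have fF : lfin fsize F by apply: lfin_sub fI => ts [].
rewrite tgf_node // mulrBr mulr1 -fgf_forests // -fgf_ins //; last first.
- by move=> ts t Uts /Uts Ut /dAU.
- exact: lfin_forests.
have -> : ins A (forests U) = F `|` [set [:: t] | t in A].
  apply/seteqP; split=> [ts Its|ts [[]//|[t At <-]]]; last first.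
    by exists [::], t, [::].
  case: (Its) => ts1 [t [ts2 [tsE At _]]].
  have [sz|sz] := ltnP 1%N (size ts); first by left.
  right; exists t => //; move: sz; rewrite tsE size_cat /= addnS ltnS leqn0 addn_eq0.
  by move=> /andP[/eqP/size0nil-> /eqP/size0nil->].
have fA1 : lfin fsize [set [:: t] | t in A].
  move=> n; apply: sub_finite_set (finite_image (fun t => [:: t]) (fA n)).
  by move=> _ [[t At <-]]; rewrite /fsize /fleaves /= cats0 => tn; exists t.
rewrite [X in X - _]gfU //; last by move=> ts [_ sz] [t _ ts1]; rewrite -ts1 in sz.
rewrite [X in _ + X - _](_ : _ = tgf A) ?addrK //.
apply: (@gf_inj _ _ _ _ _ _ (fun t => [:: t])) => //.
  by move=> t u _ _ [].
move=> t _; rewrite /fsize /fleaves /= cats0; split=> //.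
by rewrite /fweight /fprod big_seq1 divr1.
Qed.
End Forests.

(** * Reordering classes *)

Lemma coef_XM (f : fps) n :
  coefs (fps_X * f) n = if n is n'.+1 then coefs f n' else 0.
Proof.
rewrite /= big_ord_recl /= mul0r add0r; case: n => [|n]; first by rewrite big_ord0.
rewrite big_ord_recl /= mul1r subSS subn0 big1 ?addr0 // => i _.
by rewrite mul0r.
Qed.

Lemma coef_Xn n m : coefs (fps_X ^+ n) m = (m == n)%:R.
Proof.
elim: n m => [|n IH] m; first by rewrite expr0.
by rewrite exprS coef_XM; case: m => // m; rewrite IH eqSS.
Qed.

Section Reorder.
Variable D : Type.
Implicit Types (t u r : ptree D) (ts us rs : seq (ptree D)).

Definition cl t : tree D := \pi_(tree D) t.

Lemma clP t u : cl t = cl u <-> reorder t u.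
Proof.
by split=> [/eqmodP /asboolP|tu]; last by apply/eqmodP/asboolP.
Qed.

Lemma reorder_leaves t u : reorder t u -> perm_eq (leaves t) (leaves u).
Proof.
elim=> {t u} [t|t u _ IH|t u v _ IH1 _ IH2|d ts us tu|d ts t u us _ IH] //=.
- by rewrite perm_sym.
- exact: perm_trans IH1 IH2.
- exact: perm_fleaves.
- by rewrite !map_cat !flatten_cat /= perm_cat2l perm_cat2r.
Qed.

Lemma reorder_no_unary t u : reorder t u -> no_unary t = no_unary u.
Proof.
elim=> {t u} [t|t u _ IH|t u v _ IH1 _ IH2|d ts us tu|d ts t u us _ IH] //=.
- by rewrite IH1.
- by rewrite (perm_size tu) (perm_all _ tu).
- by rewrite !size_cat !all_cat /= IH.
Qed.

Lemma reorder_leaf_dist t u a h : reorder t u -> leaf_dist a t h = leaf_dist a u h.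
Proof.
move=> tu; elim: tu h
  => {t u} [t|t u _ IH|t u v _ IH1 _ IH2|d ts us tu|d ts t u us _ IH] //= h.
- by rewrite IH1.
- by case: h => //= h; apply: perm_has.
- by case: h => //= h; rewrite !has_cat /= IH.
Qed.

(** Symmetry and transitivity are constructors of [reorder], so inversion says nothing; this
    invariant, preserved by all five constructors, takes its place. *)
Lemma reorder_cl t u : reorder t u ->
  match t, u with
  | Leaf a, Leaf b => a = b
  | Node d ts, Node e us => d = e /\ perm_eq (map cl ts) (map cl us)
  | _, _ => False
  end.
Proof.
elim=> {t u} [[a|d ts]|[a|d ts] [b|e us] _|[a|d ts] [b|e us] [c|f vs] _|
  d ts us|d ts t u us /clP tu _] //=.
- by case=> -> tu; rewrite perm_sym.
- by move=> -> _ ->.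
- by case=> -> tu _ [-> uv]; split=> //; apply: perm_trans uv.
- by move=> tu; split=> //; apply: perm_map.
- by rewrite !map_cat /= tu.
Qed.

Lemma reorder_leafl a t : reorder (Leaf a) t -> t = Leaf a.
Proof. by case: t => [b|d ts] /reorder_cl // ->. Qed.

Lemma reorder_leafr a t : reorder t (Leaf a) -> t = Leaf a.
Proof. by move/reorder_sym/reorder_leafl. Qed.

(** A permutation of lists of classes becomes an insertion, the operation whose series [fgf_ins]
    computes. *)
Lemma cl_ins r us (cs : seq (tree D)) : perm_eq (map cl us) (cl r :: cs) <->
  exists us1 u us2, [/\ us = us1 ++ u :: us2, reorder u r &
                        perm_eq (map cl (us1 ++ us2)) cs].
Proof.
split=> [ucs|[us1 [u [us2 [-> /clP ur]]]]]; last first.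
  rewrite !map_cat /= ur => p.
  by rewrite perm_catC /= perm_cons perm_catC.
have : cl r \in map cl us by rewrite (perm_mem ucs) mem_head.
move=> /mapP[u uus ru]; case/splitPr: uus ucs => us1 us2 ucs.
exists us1, u, us2; split=> //; first exact/clP.
by move: ucs; rewrite !map_cat /= perm_catC /= ru perm_cons perm_catC.
Qed.

Lemma reorder_nodes d ts us : perm_eq (map cl ts) (map cl us) ->
  reorder (Node d ts) (Node d us).
Proof.
(* [pre] holds the children already matched: they stay below the same root while the remaining ones
   are treated one at a time. *)
rewrite -[ts]cat0s -[us]cat0s; move: [::] => pre.
elim: us ts pre => [|u us IH] ts pre.
  rewrite !map_cat perm_cat2l => /perm_size/eqP; rewrite size_map => /eqP/size0nil->.
  exact: reorder_refl.
rewrite !map_cat perm_cat2l /= => /cl_ins[ts1 [t [ts2 [-> tu p]]]].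
apply: reorder_trans (_ : reorder _ (Node d (pre ++ t :: ts1 ++ ts2))) _.
  by apply: reorder_perm; rewrite perm_cat2l perm_catC /= perm_cons perm_catC.
apply: reorder_trans (_ : reorder _ (Node d (pre ++ u :: ts1 ++ ts2))) _.
  exact: reorder_child.
rewrite -!cat_rcons; apply: IH.
by rewrite !map_cat perm_cat2l -map_cat.
Qed.

Lemma reorder_nodeP d e ts us : reorder (Node d ts) (Node e us) <->
  d = e /\ perm_eq (map cl ts) (map cl us).
Proof. by split=> [/reorder_cl|[-> /reorder_nodes]]. Qed.

(** Equivalent trees have the same leaf labels, and [r] has at least one, which distinctness keeps
    out of [rs]. *)
Lemma disjoint_cl rs r ts t : perm_eq (map cl ts) (map cl rs) -> t \in ts ->
  no_unary r -> uniq (leaves r ++ fleaves rs) -> ~ reorder t r.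
Proof.
move=> p tts /size_leaves_gt0 + un tr.
have : cl t \in map cl rs by rewrite -(perm_mem p) map_f.
move=> /mapP[r' r'rs /clP tr'].
move: un; rewrite cat_uniq => /and3P[_ /hasPn un _].
case rE : (leaves r) un => [//|a s] un _.
have ar : a \in leaves r by rewrite rE mem_head.
have/un : a \in fleaves rs.
  rewrite mem_fleaves; apply/hasP; exists r' => //.
  by rewrite -(perm_mem (reorder_leaves tr')) (perm_mem (reorder_leaves tr)).
by rewrite /= mem_head.
Qed.

(** The class of a node is built by inserting a member of the class of each child in turn, so the
    series multiply; each leaf brings one factor [fps_X]. The coefficient 1 is the total weight of
    the class. *)
Lemma reorder_class t : no_unary t -> uniq (leaves t) ->
  lfin (@n_leaves D) [set u | reorder u t] /\
  tgf [set u | reorder u t] = fps_X ^+ n_leaves t.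
Proof.
elim/ptree_ind_mem: t => [a _ _|d ts IH /= /andP[_ nut] unt].
  have -> : [set u | reorder u (Leaf a)] = [set Leaf a : ptree D].
    apply/seteqP; split=> [u /reorder_leafr//|_ ->]; exact: reorder_refl.
  by rewrite tgf_leaf expr1; split=> //; apply: lfin_leaf.
have -> : [set u | reorder u (Node d ts)] =
    [set Node d us | us in [set us : seq (ptree D) | perm_eq (map cl us) (map cl ts)]].
  apply/seteqP; split=> [[a /reorder_leafl//|e us /reorder_nodeP[-> p]]|].
    by exists us.
  by move=> _ [us p <-]; apply/reorder_nodeP.
suff [lF gF] :
    lfin (@fsize D) [set us : seq (ptree D) | perm_eq (map cl us) (map cl ts)] /\
    fgf [set us : seq (ptree D) | perm_eq (map cl us) (map cl ts)] = fps_X ^+ fsize ts.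
  by split; [apply: lfin_node|rewrite tgf_node].
elim: ts IH nut unt => [_ _ _|t ts IHts IH /= /andP[nut nuts] un].
  have -> : [set us : seq (ptree D) | perm_eq (map cl us) (map cl [::])] =
      [set [::]] :> set (seq (ptree D)).
    apply/seteqP; split=> [us /perm_size/eqP|_ ->//].
    by rewrite size_map => /eqP/size0nil ->.
  split; first by move=> n; apply: sub_finite_set (finite_set1 [::]) => us [].
  by rewrite expr0 fgf_nil.
have -> : [set us : seq (ptree D) | perm_eq (map cl us) (cl t :: map cl ts)] =
    ins [set u | reorder u t]
      [set us : seq (ptree D) | perm_eq (map cl us) (map cl ts)].
  by apply/seteqP; split=> us /cl_ins.
have /and3P[unt _ unts] : [&& uniq (leaves t), ~~ has (mem (leaves t)) (fleaves ts)
    & uniq (fleaves ts)] by rewrite -cat_uniq.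
have [u uts|lF gF] := IHts _ nuts unts.
  by apply: IH; rewrite inE uts orbT.
have [lt gt] := IH t (mem_head _ _) nut unt.
split; first exact: lfin_ins.
rewrite fgf_ins //.
  by rewrite gF gt -exprD -cat1s fsize_cat {2}/fsize /fleaves /= cats0.
by move=> us u p uus; apply: disjoint_cl p uus nut un.
Qed.

Lemma wsum_reorder t : no_unary t -> uniq (leaves t) ->
  wsum (@weight D) [set u | reorder u t] = 1.
Proof.
move=> nut unt; have [_ /(congr1 (fun f => coefs f (n_leaves t)))] :=
  reorder_class nut unt.
rewrite coef_Xn eqxx mulr1n => <- /=; congr wsum; apply/seteqP; split=> [u ut|u []//].
by split=> //; apply/perm_size/reorder_leaves.
Qed.
End Reorder.

(** * From labelled trees to marked trees *)

Fixpoint relabel (D : Type) (f : nat -> nat) (t : ptree D) : ptree D :=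
  match t with
  | Leaf a => Leaf (f a)
  | Node d ts => Node d (map (relabel f) ts)
  end.

(* Leaf labels of a tree with k marked leaves: [i.+1] for the leaf marked by the
   i-th entry of I, and 0 for an unmarked leaf. *)
Definition mark (I : seq nat) (a : nat) : nat :=
  if a \in I then (index a I).+1 else 0%N.

Definition marks (D : Type) (t : ptree D) : seq nat :=
  [seq a <- leaves t | a != 0%N].

Section Relabel.
Variable D : Type.
Implicit Types (t u : ptree D) (f g : nat -> nat).

Lemma leaves_relabel f t : leaves (relabel f t) = map f (leaves t).
Proof.
elim/ptree_ind_mem: t => //= d ts IH; rewrite map_flatten -!map_comp.
by congr flatten; apply/eq_in_map => t /IH.
Qed.

Lemma n_leaves_relabel f t : n_leaves (relabel f t) = n_leaves t.
Proof. by rewrite /n_leaves leaves_relabel size_map. Qed.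

Lemma no_unary_relabel f t : no_unary (relabel f t) = no_unary t.
Proof.
elim/ptree_ind_mem: t => //= d ts IH; rewrite size_map all_map.
by congr andb; apply: eq_in_all => t /IH.
Qed.

Lemma weight_relabel f t : weight (relabel f t) = weight t.
Proof.
elim/ptree_ind_mem: t => //= d ts IH; rewrite size_map -map_comp.
by congr (\prod_(x <- _) _ / _); apply/eq_in_map => t /IH.
Qed.

Lemma relabel_comp f g t : relabel f (relabel g t) = relabel (f \o g) t.
Proof.
elim/ptree_ind_mem: t => //= d ts IH; rewrite -map_comp.
by congr Node; apply/eq_in_map => t /IH.
Qed.

Lemma relabel_id f t : f =1 id -> relabel f t = t.
Proof.
move=> fid; elim/ptree_ind_mem: t => [a|d ts IH] /=; first by rewrite fid.
by congr Node; rewrite -[RHS]map_id; apply/eq_in_map => t /IH.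
Qed.

Lemma reorder_relabel f t u : reorder t u -> reorder (relabel f t) (relabel f u).
Proof.
elim=> {t u} [t|t u _ IH|t u v _ IH1 _ IH2|d ts us tu|d ts t u us _ IH] /=.
- exact: reorder_refl.
- exact: reorder_sym.
- exact: reorder_trans IH1 IH2.
- exact/reorder_perm/perm_map.
- by rewrite !map_cat; apply: reorder_child.
Qed.

Lemma leaf_dist_relabel f a t h : (forall b, (f b == f a) = (b == a)) ->
  leaf_dist (f a) (relabel f t) h = leaf_dist a t h.
Proof.
move=> fa; elim/ptree_ind_mem: t h => [b|d ts IH] [|h] //=.
by rewrite has_map; apply: eq_in_has => t /IH /= ->.
Qed.

(** Setting all labels to 0 leaves the shape, which fixes the number of leaves of each child and
    hence where the leaf word is cut. *)
Lemma shape_leaves_inj t u : relabel (fun=> 0%N) t = relabel (fun=> 0%N) u ->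
  leaves t = leaves u -> t = u.
Proof.
elim/ptree_ind_mem: t u => [a|d ts IH] [b|e us] //=; first by move=> _ [->].
case=> <- {e} sh lv; congr Node.
elim: ts us IH sh lv => [|t ts IHts] [|u us] //= IH [sht shts].
have szE : size (leaves t) = size (leaves u).
  by rewrite -[LHS](n_leaves_relabel (fun=> 0%N)) sht n_leaves_relabel.
move/eqP; rewrite eqseq_cat // => /andP[/eqP ltu /eqP lts].
rewrite (IH t (mem_head _ _) u sht ltu); congr cons; apply: IHts => //.
by move=> v vts; apply: IH; rewrite inE vts orbT.
Qed.

(** With [shape_leaves_inj], identifies a tree with its shape and an arbitrary leaf word of the
    right length. *)
Lemma exists_relabelled t (l : seq nat) : size l = n_leaves t ->
  exists2 u, relabel (fun=> 0%N) u = relabel (fun=> 0%N) t & leaves u = l.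
Proof.
elim/ptree_ind_mem: t l => [a [|b []] // _|d ts IH l].
  by exists (Leaf b).
rewrite /n_leaves /= => szl.
suff [us sh lv] : exists2 us, map (relabel (fun=> 0%N)) us =
    map (@relabel D (fun=> 0%N)) ts & fleaves us = l.
  by exists (Node d us); rewrite //= sh.
elim: ts l szl IH => [|t ts IHts] l /=; first by move=> /size0nil-> _; exists [::].
rewrite size_cat => szl IH.
have [|u shu lu] := IH t (mem_head _ _) (take (n_leaves t) l).
  by rewrite size_takel // szl leq_addr.
have [||us shus lus] := IHts (drop (n_leaves t) l).
- by rewrite size_drop szl addKn.
- by move=> v vts; apply: IH; rewrite inE vts orbT.
exists (u :: us); first by rewrite /= shu shus.
by rewrite -cat1s fleaves_cat lus {1}/fleaves /= cats0 lu cat_take_drop.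
Qed.

End Relabel.

Lemma labeled_uniq (D : Type) n (t : ptree D) : labeled n t -> uniq (leaves t).
Proof. by move=> /andP[_ /perm_uniq->]; apply: iota_uniq. Qed.

Lemma labeled_size (D : Type) n (t : ptree D) : labeled n t -> n_leaves t = n.
Proof. by move=> /andP[_ /perm_size]; rewrite size_iota. Qed.

Lemma reorder_labeled (D : Type) n (t u : ptree D) :
  reorder t u -> labeled n t = labeled n u.
Proof.
by move=> tu; rewrite /labeled (reorder_no_unary tu)
  (permPl (reorder_leaves tu)).
Qed.

Lemma finite_labels (D : finType) (N : nat) :
  lfin (@n_leaves D) [set t | no_unary t /\ {subset leaves t <= iota 0 N}].
Proof.
move=> n; apply: sub_finite_set (finite_image (relabel predn)
  (@finite_bounded D N n)) => t [[nut subt] tn].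
(* The label 0 is now allowed whereas [finite_bounded] starts from 1, hence the shift by one. *)
exists (relabel succn t); last by rewrite relabel_comp relabel_id.
split; rewrite ?no_unary_relabel //.
  by rewrite leaves_relabel size_map -tn.
move=> a; rewrite leaves_relabel => /mapP[b /subt bN ->].
by move: bN; rewrite !mem_iota !add0n add1n ltnS.
Qed.

Lemma lfin_marks (D : finType) (s : seq nat) :
  lfin (@n_leaves D) [set t | no_unary t /\ perm_eq (marks t) s].
Proof.
apply: lfin_sub (@finite_labels D (\max_(a <- s) a).+1) => t [nut ps].
split=> // a at_; rewrite mem_iota add0n ltnS /=.
have [->//|a0] := eqVneq a 0%N.
apply: (@leq_bigmax_seq _ s predT id) => //.
by rewrite -(perm_mem ps) mem_filter a0.
Qed.

Lemma mark_map (I : seq nat) : uniq I -> map (mark I) I = iota 1 (size I).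
Proof.
move=> uI; apply: (@eq_from_nth _ 0%N); rewrite size_map ?size_iota // => i iI.
by rewrite (nth_map 0%N) // nth_iota // /mark mem_nth // index_uniq.
Qed.

Lemma marks_mark (D : Type) (t : ptree D) (I : seq nat) : uniq (leaves t) ->
  uniq I -> {subset I <= leaves t} ->
  perm_eq (marks (relabel (mark I) t)) (iota 1 (size I)).
Proof.
move=> ut uI sub; rewrite /marks leaves_relabel filter_map -mark_map //.
apply: perm_map; apply: uniq_perm => //; first exact: filter_uniq.
move=> a; rewrite mem_filter /= /mark; case: ifP => //= aI.
by rewrite sub.
Qed.

(** Meant for nonzero labels: the label 0 of unmarked leaves may repeat, but a mark determines its
    position. *)
Lemma filter_uniq_nth (P : pred nat) (s : seq nat) i j : uniq (filter P s) ->
  (i < size s)%N -> (j < size s)%N -> P (nth 0%N s i) ->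
  nth 0%N s i = nth 0%N s j -> i = j.
Proof.
elim: s i j => //= a s IH [|i] [|j] //=.
- case: ifP => // Pa /= /andP[/negP aP _] _ js _ aj; case: aP.
  by rewrite mem_filter Pa aj mem_nth.
- case: ifP => // Pa /= => [/andP[/negP aP _] si _ Pi ai|_ _ _ Pi ai].
    by case: aP; rewrite mem_filter Pa -ai mem_nth.
  by rewrite ai Pa in Pi.
- move=> u si sj Pi ij; congr S; apply: IH => //.
  by move: u; case: ifP => // _ /= /andP[].
Qed.

Lemma finite_labeled_tuples (D : finType) (k n : nat) :
  finite_set [set p : ptree D * k.-tuple nat |
    labeled n p.1 /\ {subset p.2 <= leaves p.1}].
Proof.
have f1 := @finite_labeled D n.
have f2 := finite_seqs k (finite_seq (iota 1 n)).
(* [finite_seqs] provides sequences of length at most [k]; the default of [insubd] is taken only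
   when the length is not [k]. *)
apply: sub_finite_set (finite_image
  (fun p => (p.1, insubd (nseq_tuple k 0%N) p.2)) (finite_setX f1 f2)).
move=> [t I] [/= lt sub]; exists (t, tval I) => /=; last by rewrite valKd.
split=> //=; split; first by rewrite size_tuple.
by move=> a /sub; case/andP: lt => _ /perm_mem ->.
Qed.

(* Choosing a labelled tree and k of its leaves amounts to choosing a tree with
   leaves marked 1..k and an arbitrary order on the n labels. *)
Lemma wsum_marked (D : finType) (k n : nat) (Q : ptree D -> Prop) :
  wsum (fun p : ptree D * k.-tuple nat => weight p.1)
    [set p : ptree D * k.-tuple nat | [/\ labeled n p.1, uniq p.2,
      {subset p.2 <= leaves p.1} & Q (relabel (mark p.2) p.1)]]
  = n`!%:R * wsum (@weight D)
    [set m | [/\ no_unary m, perm_eq (marks m) (iota 1 k) & Q m]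
             /\ n_leaves m = n].
Proof.
set S := [set p | _]; set B := [set m | _].
have fB : finite_set B.
  by apply: sub_finite_set (@lfin_marks D (iota 1 k) n) => m [[]].
have fS : finite_set S.
  by apply: sub_finite_set (@finite_labeled_tuples D k n) => p [].
rewrite -wsumZ.
transitivity (wsum (fun x : ptree D * seq nat => weight x.1)
    [set x | B x.1 /\ [set l | perm_eq l (iota 1 n)] x.2]); last first.
  have fp : finite_set [set l | perm_eq l (iota 1 n)].
    apply: (@finite_seq_of _ _ (permutations (iota 1 n))) => l.
    by rewrite mem_permutations.
  rewrite (@wsum_pair _ _ B (fun=> [set l | perm_eq l (iota 1 n)])) //.
  apply: eq_wsum => // m _ /=.
  rewrite (@wsum_seq _ _ _ (permutations (iota 1 n))) ?permutations_uniq //.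
    rewrite big_const_seq count_predT iter_addr addr0 size_permutations ?iota_uniq //.
    by rewrite size_iota mulr_natl.
  by move=> l; rewrite mem_permutations.
(* The bijection keeps the marked tree and, separately, the word of the original labels read from
   left to right. *)
apply/esym; apply: (@wsum_inj _ _ _ _
  (fun p : ptree D * k.-tuple nat => (relabel (mark p.2) p.1, leaves p.1))) => //.
- move=> [t I] [u J] /= [/= lt uI sI _] [/= lu uJ sJ _] [tu ltu].
  have tuE : t = u.
    apply: shape_leaves_inj => //; move/(congr1 (relabel (fun=> 0%N))): tu.
    by rewrite !relabel_comp.
  subst u; congr pair; apply: val_inj; apply: (@eq_from_nth _ 0%N).
    by rewrite !size_tuple.
  move/(congr1 (@leaves D)): tu; rewrite !leaves_relabel => /eq_in_map mIJ i iI.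
  have := mIJ _ (sI _ (mem_nth 0%N iI)); rewrite /mark mem_nth //.
  by case: ifP => // aJ []; rewrite index_uniq // => iE; rewrite [in RHS]iE nth_index.
- move=> [m l]; split=> /=; last first.
    move=> [[t I] [/= lt uI sI QI] [<- <-]]; split; last by case/andP: lt.
    split; last by rewrite n_leaves_relabel (labeled_size lt).
    split=> //; first by rewrite no_unary_relabel; case/andP: lt.
    by rewrite -{2}(size_tuple I); apply: marks_mark => //; apply: labeled_uniq lt.
  move=> [[[num pm Qm] mn] pl].
  have szl : size l = n by rewrite (perm_size pl) size_iota.
  have ul : uniq l by rewrite (perm_uniq pl) iota_uniq.
  have [u shu lu] := @exists_relabelled D m l (etrans szl (esym mn)).
  (* [g i] is the label that [l] places where [m] carries the mark [i]; the tuple sought is [g]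
     applied to 1, ..., [k]. *)
  pose g i := nth 0%N l (index i (leaves m)).
  have gm i : i \in iota 1 k -> i \in leaves m.
    by rewrite -(perm_mem pm) mem_filter => /andP[].
  have gl i : i \in iota 1 k -> (index i (leaves m) < size l)%N.
    by move=> /gm im; rewrite szl -mn index_mem.
  have ginj : {in iota 1 k &, injective g}.
    move=> i j ik jk /eqP; rewrite nth_uniq ?gl // => /eqP ij.
    by rewrite -(nth_index 0%N (gm _ ik)) ij nth_index ?gm.
  have szI : size (map g (iota 1 k)) == k by rewrite size_map size_iota.
  have uI : uniq (map g (iota 1 k)) by rewrite map_inj_in_uniq // iota_uniq.
  have mE : relabel (mark (map g (iota 1 k))) u = m.
    apply: shape_leaves_inj; first by rewrite relabel_comp shu.
    rewrite leaves_relabel lu; apply: (@eq_from_nth _ 0%N).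
      by rewrite size_map szl.
    move=> j; rewrite size_map => jl; rewrite (nth_map 0%N) //.
    have jm : (j < size (leaves m))%N by move: jl; rewrite szl -mn.
    have [c0|c0] := eqVneq (nth 0%N (leaves m) j) 0%N.
      rewrite c0 /mark ifN //; apply/mapP => -[i ik /eqP].
      rewrite nth_uniq ?gl // => /eqP ji; move: c0; rewrite ji nth_index ?gm //.
      by move=> i0; rewrite i0 mem_iota in ik.
    move: c0; set c := nth 0%N (leaves m) j => c0.
    have ck : c \in iota 1 k.
      by rewrite -(perm_mem pm) mem_filter c0 mem_nth.
    have cj : nth 0%N l j = g c.
      congr nth; apply: (@filter_uniq_nth (fun a => a != 0%N) (leaves m)) => //.
      - by rewrite -/(marks m) (perm_uniq pm) iota_uniq.
      - by rewrite index_mem mem_nth.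
      - by rewrite nth_index ?mem_nth.
    rewrite cj /mark map_f //.
    (* Marks start from 1 and positions from 0. *)
    have cE : c = nth 0%N (iota 1 k) c.-1.
      by move: ck; rewrite mem_iota; case: (c) => // c' /= ck'; rewrite nth_iota.
    have ck1 : (c.-1 < k)%N by move: ck; rewrite mem_iota; case: (c).
    rewrite {1}cE -(nth_map 0%N 0%N) ?size_iota // index_uniq ?(eqP szI) //.
    by rewrite prednK // lt0n.
  exists (u, Tuple szI); last by rewrite /= mE lu.
  split=> //=; rewrite ?mE //.
  - by rewrite /labeled lu pl andbT -(no_unary_relabel (mark (map g (iota 1 k)))) mE.
  - by move=> _ /mapP[i /gl ik ->]; rewrite lu mem_nth.
- by move=> [t I] _; rewrite weight_relabel.
Qed.

(** * The series L, L_even and L_odd *)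

(** By invariance of [P], the trees counted form a union of whole reordering classes, each of weight
    1 by [wsum_reorder]. *)
Lemma count_treesE (D : finType) (P : ptree D -> Prop) n :
  (forall t u, reorder t u -> P t -> P u) ->
  (count_trees P n)%:R = wsum (@weight D) [set t | labeled n t /\ P t].
Proof.
move=> Pinv; apply: wsum_card.
  by apply: sub_finite_set (@finite_labeled D n) => t [].
move=> t [lt Pt]; rewrite -[RHS](@wsum_reorder D t).
- congr wsum; apply/seteqP; split=> u /=.
    by move=> [_ /clP].
  move=> /[dup] ut /clP ut'; split=> //; split.
    by rewrite (reorder_labeled n ut).
  by apply: Pinv Pt; apply: reorder_sym.
- by case/andP: lt.
- exact: labeled_uniq lt.
Qed.

Lemma marks_node (D : Type) d (ts : seq (ptree D)) :
  marks (Node d ts) = flatten (map (@marks D) ts).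
Proof. by rewrite /marks /= filter_flatten -map_comp. Qed.

(** All leaves carry 0, so these are plane trees without labels. *)
Definition unmarked (D : Type) : set (ptree D) :=
  [set t | no_unary t /\ marks t = [::]].
Arguments unmarked : clear implicits.

Lemma unmarked_gt0 D t : unmarked D t -> (0 < n_leaves t)%N.
Proof. by move=> [/size_leaves_gt0]. Qed.

Lemma lfin_unmarked (D : finType) : lfin (@n_leaves D) (unmarked D).
Proof.
by apply: lfin_sub (@lfin_marks D [::]) => t [nu m0]; split=> //; rewrite m0.
Qed.

(** Case [k = 0] of [wsum_marked]: the orders of the labels cancel the factorial of the exponential
    generating function. *)
Lemma L_gf : L = tgf (unmarked unit).
Proof.
apply: fpsP => n /=; rewrite count_treesE //.
have -> : wsum (@weight unit) [set t | labeled n t /\ True] =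
    n`!%:R * wsum (@weight unit) [set x | unmarked unit x /\ n_leaves x = n].
  have <- : [set m : ptree unit | [/\ no_unary m, perm_eq (marks m) (iota 1 0) & True]
             /\ n_leaves m = n] = [set x | unmarked unit x /\ n_leaves x = n].
    apply/seteqP; split=> t [[nu] m0].
      by move=> _ tn; split=> //; split=> //; apply/nilP; rewrite /nilp (perm_size m0).
    by split=> //; split; rewrite ?m0.
  rewrite -(@wsum_marked _ 0).
  apply/esym; apply: (@wsum_inj _ _ _ _ (fun t => (t, [tuple of [::]]))) => //.
  - by apply: sub_finite_set (@finite_labeled _ n) => t [].
  - by move=> t u _ _ [].
  - move=> [t I]; split=> [[/= lt _ _ _]|[u [lt _] [<- <-]]]; last by split.
    by exists t => //; rewrite (tuple0 I).
by rewrite mulrC mulKf // pnatr_eq0 -lt0n fact_gt0.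
Qed.

(** * Parity of the depth of a distinguished leaf *)

Definition parity (D : Type) (b : bool) (a : nat) (t : ptree D) : Prop :=
  exists2 h, leaf_dist a t h & odd h = b.

Lemma reorder_parity (D : Type) b a (t u : ptree D) :
  reorder t u -> parity b a t -> parity b a u.
Proof. by move=> tu [h th hb]; exists h => //; rewrite -(reorder_leaf_dist _ _ tu). Qed.

Lemma leaf_dist_mem (D : Type) a (t : ptree D) h : leaf_dist a t h -> a \in leaves t.
Proof.
elim/ptree_ind_mem: t h => [b|d ts IH] [|h] //=; first by rewrite inE eq_sym.
by move=> /hasP[t tts /(IH t tts) at_]; rewrite -/(fleaves ts) mem_fleaves;
  apply/hasP; exists t.
Qed.

Lemma leaf_dist_ex (D : Type) a (t : ptree D) : a \in leaves t ->
  exists h, leaf_dist a t h.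
Proof.
elim/ptree_ind_mem: t => [b|d ts IH] /=.
  by rewrite inE => /eqP->; exists 0%N => /=.
rewrite -/(fleaves ts) mem_fleaves => /hasP[t tts /(IH t tts)[h th]].
by exists h.+1; apply/hasP; exists t.
Qed.

Lemma leaf_dist_uniq (D : Type) a (t : ptree D) h h' : uniq (leaves t) ->
  leaf_dist a t h -> leaf_dist a t h' -> h = h'.
Proof.
elim/ptree_ind_mem: t h h' => [b|d ts IH] [|h] [|h'] //= uts.
move=> /hasP[t tts th] /hasP[u uts' uh']; congr S.
have at_ := leaf_dist_mem th; have au := leaf_dist_mem uh'.
case/splitPr: tts uts IH uts' => ts1 ts2.
rewrite map_cat flatten_cat /= uniq_catCA -/(fleaves ts1) -/(fleaves ts2) -fleaves_cat.
rewrite cat_uniq => /and3P[ut /hasPn nt _] IH.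
have : ~~ (a \in fleaves (ts1 ++ ts2)) by apply/negP => /nt /=; rewrite at_.
rewrite mem_fleaves => /hasPn na; rewrite mem_cat inE => u12.
have /eqP ut_ : u == t.
  apply/negPn/negP => ut_; move: u12; rewrite (negPf ut_) /= -mem_cat => /na.
  by rewrite au.
by subst u; apply: IH uh' => //; rewrite mem_cat mem_head orbT.
Qed.

Definition L_parity (b : bool) : fps :=
  egf (fun n => count_trees (@parity unit b n.+1) n.+1).

Lemma L_evenE : L_even = L_parity false.
Proof.
apply: fpsP => n /=; congr ((count_trees _ _)%:R / _); apply/funext => t.
by apply/propext; split=> -[h th hb]; exists h => //; [apply/negbTE|rewrite hb].
Qed.

Lemma L_oddE : L_odd = L_parity true.
Proof. by []. Qed.

(** The leaf with the largest label has a unique depth, either even or odd; singling it out costs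
    the factor [n.+1] that the derivative supplies. *)
Lemma deriv_L : fps_deriv L = L_even + L_odd.
Proof.
rewrite L_evenE L_oddE; apply: fpsP => n /=.
rewrite !count_treesE //; try by move=> t u; apply: reorder_parity.
rewrite -mulrDl -wsumU; last 3 first.
- by apply: sub_finite_set (@finite_labeled _ n.+1) => t [].
- by apply: sub_finite_set (@finite_labeled _ n.+1) => t [].
- move=> t [/labeled_uniq ut [h th hb]] [_ [h' th' hb']].
  by have hh' := leaf_dist_uniq ut th th'; rewrite -hh' hb in hb'.
rewrite factS natrM -mulr_natr.
set x := wsum _ _; set y := wsum _ _; have -> : x = y.
  congr wsum; apply/seteqP; split=> t; last by case=> -[].
  move=> [lt _]; have [|h th] := @leaf_dist_ex _ n.+1 t.
    by case/andP: lt => _ /perm_mem->; rewrite mem_iota add1n ltnS leqnn.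
  by case hb: (odd h); [right|left]; split=> //; exists h.
field; rewrite pnatr_eq0 -lt0n fact_gt0 /=.
by rewrite nat1r pnatr_eq0.
Qed.

Definition one_mark (b : bool) : set (ptree unit) :=
  [set m | [/\ no_unary m, perm_eq (marks m) [:: 1%N] & parity b 1 m]].

Definition swap (a b c : nat) := if c == a then b else if c == b then a else c.

Lemma swapK a b : involutive (swap a b).
Proof.
move=> c; rewrite /swap; have [->|ca] := eqVneq c a.
  by rewrite eqxx; case: eqVneq.
by have [->|cb] := eqVneq c b; rewrite ?eqxx ?(negPf ca) ?(negPf cb).
Qed.

Lemma labeled_swap (D : Type) n a b (t : ptree D) : a \in iota 1 n ->
  b \in iota 1 n -> labeled n t -> labeled n (relabel (swap a b) t).
Proof.
move=> an bn /andP[nut pt]; rewrite /labeled no_unary_relabel nut /=.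
rewrite leaves_relabel; apply: perm_trans (perm_map _ pt) _.
have sw c : c \in iota 1 n -> swap a b c \in iota 1 n.
  by rewrite /swap; do 2 case: ifP => //.
apply: uniq_perm; rewrite ?iota_uniq //.
  by rewrite map_inj_uniq ?iota_uniq //; apply: inv_inj (swapK a b).
move=> c; apply/mapP/idP => [[d dn ->]|cn]; first exact: sw.
by exists (swap a b c); rewrite ?sw // swapK.
Qed.

Lemma parity_relabel (D : Type) f b a (t : ptree D) :
  (forall c, (f c == f a) = (c == a)) ->
  parity b (f a) (relabel f t) <-> parity b a t.
Proof.
by move=> fa; split=> -[h th hb]; exists h => //; move: th; rewrite leaf_dist_relabel.
Qed.

(** By symmetry the distinguished leaf may carry any label instead of the largest one; multiplying
    by [fps_X] accounts for the resulting factor, and the case [k = 1] of [wsum_marked] applies. *)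
Lemma XL_parity b : fps_X * L_parity b = tgf (one_mark b).
Proof.
apply: fpsP => n; rewrite coef_XM; case: n => [|n] /=.
  rewrite (_ : [set x | _] = set0) ?wsum0 //; apply/seteqP; split=> // t.
  by move=> [[/size_leaves_gt0 t0 _ _] tn]; move: t0; rewrite -/(n_leaves t) tn.
rewrite count_treesE; last by move=> t u; apply: reorder_parity.
set x := wsum _ _; have : x *+ n.+1 = n.+1`!%:R *
   wsum (@weight unit) [set x | one_mark b x /\ n_leaves x = n.+1].
  rewrite -[one_mark b]/[set m |
    [/\ no_unary m, perm_eq (marks m) (iota 1 1) & parity b 1 m]].
  rewrite -(@wsum_marked _ 1 n.+1 (parity b 1)).
  transitivity (wsum (fun p : nat * ptree unit => weight p.2)
    [set p | [set a | a \in iota 1 n.+1] p.1 /\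
             [set t | labeled n.+1 t /\ parity b p.1 t] p.2]).
    rewrite (@wsum_pair _ _ [set a | a \in iota 1 n.+1]
      (fun a => [set t | labeled n.+1 t /\ parity b a t])); last 2 first.
    - by apply: (@finite_seq_of _ _ (iota 1 n.+1)).
    - by move=> a _; apply: sub_finite_set (@finite_labeled _ n.+1) => t [].
    transitivity (wsum (fun=> x) [set a | a \in iota 1 n.+1]).
      rewrite (@wsum_seq _ _ _ (iota 1 n.+1)) ?iota_uniq //.
      by rewrite big_const_seq count_predT iter_addr addr0 size_iota.
    (* Exchanging the labels [a] and [n.+1] preserves weights and depths, so every choice of [a]
       contributes [x]. *)
    apply: eq_wsum => [|a /= an]; first by apply: (@finite_seq_of _ _ (iota 1 n.+1)).
    have nn : n.+1 \in iota 1 n.+1 by rewrite mem_iota add1n ltnS leqnn.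
    have swE c d : (swap a n.+1 c == swap a n.+1 d) = (c == d).
      exact: inj_eq (inv_inj (swapK a n.+1)) _ _.
    have swn : swap a n.+1 n.+1 = a.
      by rewrite /swap eqxx; case: eqVneq.
    have swa : swap a n.+1 a = n.+1 by rewrite /swap eqxx.
    apply: (@wsum_inj _ _ _ _ (relabel (swap a n.+1))).
    - by apply: sub_finite_set (@finite_labeled _ n.+1) => t [].
    - move=> t u _ _ /(congr1 (relabel (swap a n.+1))).
      by rewrite !relabel_comp !relabel_id //; apply: swapK.
    - move=> t; split=> [[lt pt]|[u [lu pu] <-]].
        exists (relabel (swap a n.+1) t); last first.
          by rewrite relabel_comp relabel_id //; apply: swapK.
        by split; [exact: labeled_swap|rewrite -{1}swn; apply/parity_relabel].
      split; first exact: labeled_swap.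
      by rewrite -{1}swa; apply/parity_relabel.
    - by move=> t _; rewrite weight_relabel.
  have mark1 a c : (mark [:: a] c == 1%N) = (c == a).
    by rewrite /mark inE /= [a == c]eq_sym; case: (c == a).
  have markE a t : parity b 1 (relabel (mark [:: a]) t) <-> @parity unit b a t.
    have ma : mark [:: a] a = 1%N by apply/eqP; rewrite mark1.
    by rewrite -{1}ma; apply: parity_relabel => c; rewrite ma mark1.
  apply/esym; apply: (@wsum_inj _ _ _ _
    (fun p : nat * ptree unit => (p.2, [tuple p.1]))) => //.
  - apply: (@finite_setXR _ _ [set a | a \in iota 1 n.+1]
      (fun a => [set t | labeled n.+1 t /\ parity b a t])).
      by apply: (@finite_seq_of _ _ (iota 1 n.+1)).
    by move=> a _; apply: sub_finite_set (@finite_labeled _ n.+1) => t [].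
  - by move=> [a t] [c u] _ _ [-> ->].
  - move=> [t I]; split=> [[/= lt _ sub QI]|[[a u] [/= an [lu pu]] [<- <-]]].
      case: I sub QI => [[|a [|? ?]] //= szI] sub /markE QI.
      exists (a, t) => /=; last by congr pair; apply: val_inj.
      by split=> //; case/andP: lt => _ /perm_mem <-; apply: sub; rewrite mem_head.
    split=> //=; last exact/markE.
    by move=> c; rewrite inE => /eqP ->; case/andP: lu => _ /perm_mem ->.
rewrite factS natrM => xE.
apply: (@mulfI _ n.+1%:R); first by rewrite pnatr_eq0.
have n0 : n`!%:R != 0 :> rat by rewrite pnatr_eq0 -lt0n fact_gt0.
by rewrite mulrA mulr_natl xE mulrAC mulfK.
Qed.

Lemma fps_XI (f g : fps) : fps_X * f = fps_X * g -> f = g.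
Proof.
move=> fg; apply: fpsP => n; have := congr1 (fun h => coefs h n.+1) fg.
by rewrite !coef_XM.
Qed.

Lemma perm_eq_seq1 (s : seq nat) a : perm_eq s [:: a] -> s = [:: a].
Proof. by move/perm_small_eq; apply. Qed.

(** The marked leaf lies in exactly one child, where its depth is one less and its parity flips; the
    other children are unmarked. *)
Lemma one_mark_node b d (ts : seq (ptree unit)) : one_mark b (Node d ts) <->
  ins (one_mark (~~ b)) (forests (unmarked unit)) ts /\ (1 < size ts)%N.
Proof.
split=> [[/= /andP[sz nu] mts [[//|h] /= /hasP[t tts th] hb]]|].
  split=> //; case/splitPr: tts nu mts sz => ts1 ts2.
  rewrite all_cat /= marks_node map_cat flatten_cat /= => /and3P[nu1 nut nu2] mts _.
  have mt1 : 1%N \in marks t by rewrite mem_filter (leaf_dist_mem th).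
  have [m1 mt m2] : [/\ flatten (map (@marks unit) ts1) = [::],
      marks t = [:: 1%N] & flatten (map (@marks unit) ts2) = [::]].
    move: mts; rewrite perm_catC -catA => /[dup] /perm_size + /perm_eq_seq1.
    case: (marks t) mt1 => [//|x s] _ /= [] /eqP; rewrite !size_cat !addn_eq0.
    by move=> /and3P[/eqP/size0nil-> /eqP/size0nil-> /eqP/size0nil->] [->].
  exists ts1, t, ts2; split=> //.
    by split; rewrite ?mt //; exists h => //; rewrite -hb /= negbK.
  have mU s : all (@no_unary unit) s -> flatten (map (@marks unit) s) = [::] ->
      forests (unmarked unit) s.
    move=> nus ms u us; split; first exact: (allP nus).
    case/splitPr: us ms => s1 s2; rewrite map_cat flatten_cat /=.
    by case: (flatten _) (marks u) => // -[].
  by move=> u; rewrite mem_cat => /orP[]; [apply: (mU ts1)|apply: (mU ts2)].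
move=> [[ts1 [t [ts2 [-> [nut mt [h th hb]] Uts]]]] sz].
have U0 s : (forall u, u \in s -> unmarked unit u) ->
    all (@no_unary unit) s /\ flatten (map (@marks unit) s) = [::].
  move=> Us; split; first by apply/allP => u /Us[].
  elim: s Us => //= u s IH Us; have [_ ->] := Us u (mem_head _ _).
  by apply: IH => v vs; apply: Us; rewrite inE vs orbT.
have [nu1 m1] : all (@no_unary unit) ts1 /\ flatten (map (@marks unit) ts1) = [::].
  by apply: U0 => u us; apply: Uts; rewrite mem_cat us.
have [nu2 m2] : all (@no_unary unit) ts2 /\ flatten (map (@marks unit) ts2) = [::].
  by apply: U0 => u us; apply: Uts; rewrite mem_cat us orbT.
split.
- by rewrite /= sz all_cat /= nu1 nut.
- by rewrite marks_node map_cat flatten_cat /= m1 m2 cats0.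
- exists h.+1; last by rewrite /= hb negbK.
  by rewrite /= has_cat /= th orbT.
Qed.

Lemma lfin_one_mark b : lfin (@n_leaves unit) (one_mark b).
Proof. by apply: lfin_sub (@lfin_marks _ [:: 1%N]) => t []. Qed.

Lemma one_mark_path b :
  tgf [set Node tt ts | ts in
    [set ts | ins (one_mark b) (forests (unmarked unit)) ts /\ (1 < size ts)%N]]
  = tgf (one_mark b) * (fps_exp L - 1).
Proof.
rewrite L_gf; apply: tgf_path.
- exact: unmarked_gt0.
- exact: lfin_unmarked.
- exact: lfin_one_mark.
- by move=> t [_ mt _] [_ m0]; rewrite m0 in mt.
Qed.

Lemma L_odd_rec : L_odd = L_even * (fps_exp L - 1).
Proof.
rewrite L_evenE L_oddE; apply: fps_XI; rewrite mulrA !XL_parity -one_mark_path.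
congr tgf; apply/seteqP; split=> [[a|[] ts]|_ [ts Its <-]].
- by move=> [_ _ [[|h]]].
- by move=> /one_mark_node Its; exists ts.
- exact/one_mark_node.
Qed.

(** Besides the trees with a root node, handled as in [L_odd_rec], there is the single leaf, at
    depth 0; it gives the term 1 once [fps_X] is cancelled. *)
Lemma L_even_rec : L_even = 1 + L_odd * (fps_exp L - 1).
Proof.
rewrite L_evenE L_oddE; apply: fps_XI.
rewrite mulrDr mulr1 mulrA !XL_parity -one_mark_path -(tgf_leaf unit 1) -gfU.
- congr tgf; apply/seteqP; split=> [[a|[] ts]|_ [->|[ts Its <-]]].
  + move=> [_ _ [[|h]] //= /eqP -> _]; by left.
  + by move=> /one_mark_node Its; right; exists ts.
  + by split=> //; exists 0%N.
  + exact/one_mark_node.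
- exact: lfin_leaf.
- apply: lfin_sub (lfin_one_mark false) => _ [ts Its <-]; exact/one_mark_node.
- by move=> _ -> [].
Qed.

(** * Induced trees *)

(** Counterpart of [restrict] for marked trees: leaves labelled 0 are pruned, and a node stays only
    if at least two of its children leave something. *)
Fixpoint strip (D : Type) (t : ptree D) : seq (ptree D) :=
  match t with
  | Leaf a => if a == 0%N then [::] else [:: Leaf a]
  | Node d ts =>
      let us := flatten (map (@strip D) ts) in
      if (1 < size us)%N then [:: Node d us] else us
  end.

Section Strip.
Variable D : Type.
Implicit Types (t u r : ptree D) (ts us rs : seq (ptree D)).

Lemma size_strip t : (size (strip t) <= 1)%N.
Proof. by case: t => [a|d ts] /=; case: ifP => //; rewrite ltnNge => /negbFE. Qed.

Lemma fleaves_strip t : fleaves (strip t) = marks t.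
Proof.
elim/ptree_ind_mem: t => [a|d ts IH].
  by rewrite /marks /=; case: eqP.
have -> : fleaves (strip (Node d ts)) = fleaves (flatten (map (@strip D) ts)).
  by rewrite /=; case: ifP => // _; rewrite /fleaves /= cats0.
rewrite marks_node; elim: ts IH => //= t ts IHts IH.
rewrite fleaves_cat (IH t (mem_head _ _)) IHts // => u uts.
by apply: IH; rewrite inE uts orbT.
Qed.

Lemma no_unary_strip t : all (@no_unary D) (strip t).
Proof.
elim/ptree_ind_mem: t => [a|d ts IH] /=; first by case: eqP.
have H : all (@no_unary D) (flatten (map (@strip D) ts)).
  by apply/allP => u /flatten_mapP[t /IH /allP]; apply.
by case: ifP => //= ->; rewrite H.
Qed.

Lemma size_stripE t : size (strip t) = (marks t != [::]).
Proof.
rewrite -fleaves_strip; have := no_unary_strip t; have := size_strip t.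
case: (strip t) => [|u [|//]] //= _ /andP[/size_leaves_gt0 u0 _].
by rewrite -size_eq0 /fleaves /= cats0 -lt0n u0.
Qed.

Lemma size_strips ts :
  size (flatten (map (@strip D) ts)) = count (fun t => marks t != [::]) ts.
Proof. by elim: ts => //= t ts IH; rewrite size_cat IH size_stripE. Qed.

Lemma reorder_strip t u : reorder t u ->
  perm_eq (map (@cl D) (strip t)) (map (@cl D) (strip u)).
Proof.
elim=> {t u} [t|t u _ IH|t u v _ IH1 _ IH2|d ts us tu|d ts t u us _ IH] //.
- by rewrite perm_sym.
- exact: perm_trans IH1 IH2.
- have p : perm_eq (flatten (map (@strip D) ts)) (flatten (map (@strip D) us)).
    exact/perm_flatten/perm_map.
  rewrite /= (perm_size p); case: ifP => _; last exact: perm_map.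
  by rewrite /= (_ : cl _ = cl (Node d (flatten (map (@strip D) us)))) //;
    apply/clP/reorder_perm.
- set s1 := flatten (map (@strip D) (ts ++ t :: us)).
  set s2 := flatten (map (@strip D) (ts ++ u :: us)).
  have p : perm_eq (map (@cl D) s1) (map (@cl D) s2).
    rewrite /s1 /s2 !map_cat !flatten_cat /= !map_cat.
    by rewrite perm_cat2l perm_cat2r.
  have sz : size s1 = size s2 by move/perm_size: p; rewrite !size_map.
  rewrite /= -/s1 -/s2 sz; case: ifP => // _.
  by rewrite /= (_ : cl (Node d s1) = cl (Node d s2)) //;
    apply/clP/reorder_nodes.
Qed.

Lemma marks_mark_nil (I : seq nat) t :
  (marks (relabel (mark I) t) != [::]) = has (mem I) (leaves t).
Proof.
rewrite /marks leaves_relabel -size_eq0 size_filter -lt0n -has_count has_map.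
by apply: eq_has => a /=; rewrite /mark; case: ifP.
Qed.

(** As labels are distinct, a leaf lies in one child only: two selected leaves with no common child
    are the same as two children that each contain a selected leaf. *)
Lemma is_dcaE (I : seq nat) ts : uniq (fleaves ts) ->
  is_dca I ts = (1 < count (fun t => has (mem I) (leaves t)) ts)%N.
Proof.
move=> un; apply/idP/idP.
  move=> /hasP[a aI /hasP[b bI /and4P[_ /hasP[t tts at_] /hasP[u uts bu] /hasPn nab]]].
  case/splitPr: tts uts nab un => ts1 ts2 uts nab _.
  have : u \in ts1 ++ ts2.
    move: uts; rewrite !mem_cat inE.
    case/or3P => [->//|/eqP ut|->]; last by rewrite orbT.
    by have := nab t; rewrite mem_cat mem_head orbT at_ -ut bu => /(_ isT).
  move=> u12; rewrite count_cat /= addnCA -count_cat.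
  have -> : has (mem I) (leaves t) by apply/hasP; exists a.
  rewrite add1n ltnS -has_count; apply/hasP; exists u => //.
  by apply/hasP; exists b.
move=> c2.
have [ts1 [t [ts2 [tsE ht c1]]]] : exists ts1 t ts2, [/\ ts = ts1 ++ t :: ts2,
    has (mem I) (leaves t) & has (fun u => has (mem I) (leaves u)) ts2].
  elim: ts c2 {un} => //= t ts IH; case ht: (has _ (leaves t)) => /=.
    by rewrite add1n ltnS -has_count => c1; exists [::], t, ts.
  by rewrite add0n => /IH[ts1 [u [ts2 [-> hu c1]]]]; exists (t :: ts1), u, ts2.
case/hasP: c1 => u uts hu; case/splitPr: uts tsE => ts3 ts4 tsE.
move: un; have [/hasP[a at_ aI] /hasP[b bu bI]] := (ht, hu).
have ats : has (fun v => a \in leaves v) ts.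
  by apply/hasP; exists t => //; rewrite tsE mem_cat mem_head orbT.
have bts : has (fun v => b \in leaves v) ts.
  by apply/hasP; exists u => //; rewrite tsE !(mem_cat, inE) eqxx !orbT.
move=> un; apply/hasP; exists a => //; apply/hasP; exists b => //.
rewrite ats bts /=; move: un; rewrite tsE.
rewrite -cat1s -[u :: ts4]cat1s !fleaves_cat {2}/fleaves {3}/fleaves /= !cats0.
have dis (s1 s2 s3 : seq nat) x y : uniq (s1 ++ s2 ++ s3) -> x \in s2 ->
  y \in s1 ++ s3 -> x != y /\ x \notin s1 ++ s3.
  rewrite uniq_catCA cat_uniq => /and3P[_ /hasPn n2 _] x2 y13.
  split; first by apply: contraTneq x2 => ->; apply: n2.
  by apply/negP => /n2 /=; rewrite x2.
move=> un.
have [ab na] : a != b /\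
    a \notin fleaves ts1 ++ fleaves ts3 ++ leaves u ++ fleaves ts4.
  by apply: dis un _ _ => //; rewrite !mem_cat bu !orbT.
rewrite ab /= has_cat /= has_cat /=.
move: na; rewrite !mem_cat !mem_fleaves !negb_or => /and4P[n1 n3 nu n4].
have nb : b \notin leaves t.
  move: un; rewrite uniq_catCA cat_uniq => /and3P[_ /hasPn n2 _].
  by apply: n2; rewrite !mem_cat bu !orbT.
rewrite (negPf nb) (negPf nu) andbF /=.
have sub s : ~~ has (fun v => a \in leaves v) s ->
    has (fun v => (a \in leaves v) && (b \in leaves v)) s = false.
  by move=> /hasPn ns; apply/negbTE/hasPn => v /ns /negPf ->.
by rewrite !sub.
Qed.

Lemma restrictE (I : seq nat) t : uniq (leaves t) ->
  Defs.restrict I t = strip (relabel (mark I) t).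
Proof.
elim/ptree_ind_mem: t => [a _|d ts IH /= un].
  by rewrite /= /mark; case: ifP.
have -> : flatten (map (Defs.restrict I) ts) =
    flatten (map (@strip D) (map (relabel (mark I)) ts)).
  congr flatten; rewrite -map_comp; apply/eq_in_map => t tts /=; apply: IH => //.
  case/splitPr: tts un => ts1 ts2; rewrite map_cat flatten_cat /= uniq_catCA.
  by rewrite cat_uniq => /and3P[].
rewrite is_dcaE // size_strips count_map.
by rewrite (eq_count (a2 := fun t => has (mem I) (leaves t))) // => t /=;
  rewrite marks_mark_nil.
Qed.

End Strip.

(** * Canonical cotrees inducing a given cotree *)

Definition allowed (d : bool) (t : ptree bool) : bool :=
  [&& no_unary t, Defs.canonical t & ~~ decorated d t].

Lemma allowed_node d e ts : allowed d (Node e ts) =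
  [&& e == ~~ d, (1 < size ts)%N & all (allowed (~~ d)) ts].
Proof.
rewrite /allowed /= -[e == d]/(e == d); have -> : ~~ (e == d) = (e == ~~ d).
  by case: e d => -[].
case: eqVneq => [->|_]; rewrite ?andbF //= andbT -andbA; congr andb.
rewrite /allowed -!all_predI; apply: eq_all => t /=.
by rewrite [Defs.canonical t && _]andbC.
Qed.

Lemma reorder_canonical (t u : ptree bool) : reorder t u ->
  Defs.canonical t = Defs.canonical u /\ forall d, decorated d t = decorated d u.
Proof.
elim=> {t u} [t|t u _ [IH IHd]|t u v _ [IH1 IH1d] _ [IH2 IH2d]|d ts us tu|
  d ts t u us _ [IH IHd]] //=.
- by split=> // d; rewrite IHd.
- by split=> [|d]; [rewrite IH1|rewrite IH1d].
- by rewrite !(perm_all _ tu).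
- by rewrite !all_cat /= IH IHd.
Qed.

Lemma canonical_relabel f (t : ptree bool) :
  Defs.canonical (relabel f t) = Defs.canonical t.
Proof.
elim/ptree_ind_mem: t => //= d ts IH; rewrite !all_map; congr andb.
  by apply: eq_all => -[].
by apply: eq_in_all => t /IH.
Qed.

(** Decorations alternate along the branches of a canonical cotree, so the decoration [d] of the
    parent forces all of them; [forget] is the inverse on [allowed d] trees. *)
Fixpoint decorate (d : bool) (t : ptree unit) : ptree bool :=
  match t with
  | Leaf a => Leaf a
  | Node _ ts => Node (~~ d) (map (decorate (~~ d)) ts)
  end.

Fixpoint forget (t : ptree bool) : ptree unit :=
  match t with
  | Leaf a => Leaf a
  | Node _ ts => Node tt (map forget ts)
  end.

Lemma decorateK d : cancel (decorate d) forget.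
Proof.
move=> t; elim/ptree_ind_mem: t d => [//|[] ts IH] d /=; congr Node.
by rewrite -map_comp -[RHS]map_id; apply/eq_in_map => t tts; apply: IH.
Qed.

Lemma forgetK d t : allowed d t -> decorate d (forget t) = t.
Proof.
elim/ptree_ind_mem: t d => [//|e ts IH] d.
rewrite allowed_node => /and3P[/eqP -> _ /allP okts] /=; congr Node.
rewrite -map_comp -[RHS]map_id; apply/eq_in_map => t tts.
by apply: IH => //; apply: okts.
Qed.

Lemma leaves_decorate d t : leaves (decorate d t) = leaves t.
Proof.
elim/ptree_ind_mem: t d => //= e ts IH d; congr flatten; rewrite -map_comp.
by apply/eq_in_map => t tts; apply: IH.
Qed.

Lemma weight_decorate d t : weight (decorate d t) = weight t.
Proof.
elim/ptree_ind_mem: t d => //= e ts IH d; rewrite size_map -map_comp.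
by congr (\prod_(x <- _) _ / _); apply/eq_in_map => t tts; apply: IH.
Qed.

Lemma allowed_decorate d t : allowed d (decorate d t) = no_unary t.
Proof.
elim/ptree_ind_mem: t d => //= e ts IH d.
rewrite -/(decorate _) allowed_node eqxx /= size_map all_map.
by congr andb; apply: eq_in_all => t tts; apply: IH.
Qed.

Definition allowed_unmarked (d : bool) : set (ptree bool) :=
  [set t | allowed d t /\ marks t = [::]].

Lemma tgf_allowed_unmarked d : tgf (allowed_unmarked d) = L.
Proof.
rewrite L_gf; apply: (@gf_inj _ _ _ _ _ _ (decorate d)).
- exact: lfin_unmarked.
- by move=> t u _ _ /(can_inj (decorateK d)).
- move=> t; split=> [[okt mt]|[u [nu mu] <-]].
    exists (forget t); last exact: forgetK.
    split; first by rewrite -(allowed_decorate d) forgetK.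
    by rewrite /marks -(leaves_decorate d) forgetK.
  by split; [rewrite allowed_decorate|rewrite /marks leaves_decorate].
- by move=> t _; rewrite /n_leaves leaves_decorate weight_decorate.
Qed.

(* Trees that may be a child of a node decorated d in a canonical cotree, and whose
   marked leaves induce r. *)
Definition inducing (d : bool) (r : ptree bool) : set (ptree bool) :=
  [set t | allowed d t /\ perm_eq (map (@cl bool) (strip t)) [:: cl r]].

(** Comparing classes up to permutation leaves free which tree induces which member of [rs];
    unmarked trees strip to nothing and may be interspersed. *)
Definition finducing (d : bool) (rs : seq (ptree bool)) : set (seq (ptree bool)) :=
  [set ts | all (allowed d) ts /\
    perm_eq (map (@cl bool) (flatten (map (@strip bool) ts))) (map (@cl bool) rs)].

Lemma cl_fleaves (us rs : seq (ptree bool)) :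
  perm_eq (map (@cl bool) us) (map (@cl bool) rs) -> perm_eq (fleaves us) (fleaves rs).
Proof.
by move/(reorder_nodes true)/reorder_leaves.
Qed.

Lemma inducing_marks d r t : inducing d r t -> perm_eq (marks t) (leaves r).
Proof.
move=> [_ p]; rewrite -fleaves_strip -[leaves r]cats0.
exact: (@cl_fleaves _ [:: r]).
Qed.

Lemma lfin_inducing d r : lfin (@n_leaves bool) (inducing d r).
Proof.
apply: lfin_sub (@lfin_marks _ (leaves r)) => t tr; split.
  by case: tr => /and3P[].
exact: inducing_marks tr.
Qed.

Lemma allowed_unmarked_gt0 d t : allowed_unmarked d t -> (0 < n_leaves t)%N.
Proof. by move=> [/and3P[/size_leaves_gt0]]. Qed.

Lemma lfin_allowed_unmarked d : lfin (@n_leaves bool) (allowed_unmarked d).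
Proof. by apply: lfin_sub (@lfin_unmarked bool) => t [/and3P[]]. Qed.

Lemma strip_nil (t : ptree bool) : (strip t = [::]) <-> (marks t = [::]).
Proof.
by split=> [st|mt]; [rewrite -fleaves_strip st|apply/size0nil; rewrite size_stripE mt].
Qed.

Lemma finducing_nil d : finducing d [::] = forests (allowed_unmarked d).
Proof.
apply/seteqP; split=> [ts [/allP okts /perm_size/eqP]|ts Uts].
  rewrite size_map => /eqP/size0nil st t tts; split; first exact: okts.
  apply/strip_nil; case/splitPr: tts st => s1 s2; rewrite map_cat flatten_cat /=.
  by case: (flatten _) (strip t) => // -[].
split; first by apply/allP => t /Uts[].
suff -> : flatten (map (@strip bool) ts) = [::] by [].
apply/size0nil; rewrite size_strips; apply/eqP; rewrite -leqn0 leqNgt -has_count.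
by apply/hasPn => t /Uts[_ ->].
Qed.

(** A tree strips to at most one tree, so each entry of the flattened list has a single source. *)
Lemma flatten_strip_split (ts us1 us2 : seq (ptree bool)) u :
  flatten (map (@strip bool) ts) = us1 ++ u :: us2 ->
  exists ts1 t ts2, [/\ ts = ts1 ++ t :: ts2, strip t = [:: u],
    flatten (map (@strip bool) ts1) = us1 & flatten (map (@strip bool) ts2) = us2].
Proof.
elim: ts us1 => [|t ts IH] us1 /=; first by case: us1.
have := size_strip t; case st: (strip t) => [|v [|//]] //= _.
  move=> /IH[ts1 [t' [ts2 [-> st' <- <-]]]].
  by exists (t :: ts1), t', ts2; rewrite /= st.
case: us1 => [|v' us1] /= [vE]; rewrite {v}vE in st *.
  by move=> <-; exists [::], t, ts.
move=> /IH[ts1 [t' [ts2 [-> st' <- <-]]]].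
by exists (t :: ts1), t', ts2; rewrite /= st.
Qed.

Lemma finducing_cons d r rs :
  finducing d (r :: rs) = ins (inducing d r) (finducing d rs).
Proof.
apply/seteqP; split=> ts.
  move=> [okts /cl_ins[us1 [u [us2 [/flatten_strip_split + ur p]]]]].
  move=> [ts1 [t [ts2 [tsE st s1 s2]]]].
  move: okts; rewrite tsE all_cat /= => /and3P[ok1 okt ok2].
  exists ts1, t, ts2; split=> //.
    by split=> //; rewrite st /= (proj2 (clP _ _) ur).
  by split; rewrite ?all_cat ?ok1 // map_cat flatten_cat s1 s2.
move=> [ts1 [t [ts2 [-> [okt pt] [ok12 p]]]]].
split; first by move: ok12; rewrite !all_cat /= okt.
rewrite map_cat flatten_cat /= !map_cat perm_catCA -map_cat.
rewrite -cat1s; apply: perm_cat => //.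
by move: p; rewrite map_cat flatten_cat.
Qed.

Lemma lfin_finducing d rs : lfin (@fsize bool) (finducing d rs).
Proof.
elim: rs => [|r rs IH]; last first.
  by rewrite finducing_cons; apply: lfin_ins (@lfin_inducing _ _) IH.
rewrite finducing_nil; apply: lfin_forests (@lfin_allowed_unmarked d) => t.
exact: allowed_unmarked_gt0.
Qed.

(** Start from forests of unmarked trees, which give [fps_exp L], and insert one inducing tree per
    member of [rs]. Disjointness of the marks gives the side condition of [fgf_ins]. *)
Lemma fgf_finducing d rs : all (@no_unary bool) rs -> uniq (fleaves rs) ->
  fgf (finducing d rs) = (\prod_(r <- rs) tgf (inducing d r)) * fps_exp L.
Proof.
elim: rs => [_ _|r rs IH /= /andP[nur nurs] un].
  rewrite big_nil mul1r finducing_nil fgf_forests ?tgf_allowed_unmarked //.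
    exact: allowed_unmarked_gt0.
  exact: lfin_allowed_unmarked.
rewrite finducing_cons fgf_ins.
- rewrite IH // ?big_cons ?mulrA //; move: un.
  by rewrite -cat1s fleaves_cat cat_uniq => /and3P[].
- exact: lfin_inducing.
- exact: lfin_finducing.
- move=> ts t [_ p] tts tr; have mt := inducing_marks tr.
  have := size_leaves_gt0 nur; case lr: (leaves r) => [//|a s] _.
  have at_ : a \in marks t by rewrite (perm_mem mt) lr mem_head.
  have : a \in fleaves rs.
    rewrite -(perm_mem (cl_fleaves p)) mem_fleaves; apply/hasP.
    move: at_; rewrite -fleaves_strip mem_fleaves => /hasP[u ut au].
    by exists u => //; apply/flatten_mapP; exists t.
  move: un; rewrite -cat1s fleaves_cat {1}/fleaves /= cats0 cat_uniq.
  move=> /and3P[_ /hasPn nr _] /nr /=.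
  by rewrite lr mem_head.
Qed.

Lemma inducing_path d r : no_unary r ->
  tgf [set Node (~~ d) ts | ts in
    [set ts | finducing (~~ d) [:: r] ts /\ (1 < size ts)%N]]
  = tgf (inducing (~~ d) r) * (fps_exp L - 1).
Proof.
move=> nur; rewrite finducing_cons finducing_nil tgf_path ?tgf_allowed_unmarked //.
- exact: allowed_unmarked_gt0.
- exact: lfin_allowed_unmarked.
- exact: lfin_inducing.
- move=> t /inducing_marks mt [_ m0]; have := size_leaves_gt0 nur.
  by rewrite -(perm_size mt) m0.
Qed.

(** The trees of [inducing d r] whose root is kept as the root of [r]; there are none when the root
    of [r] is itself decorated [d]. *)
Definition top (d : bool) (r : ptree bool) : set (ptree bool) :=
  match r with
  | Leaf i => [set Leaf i]
  | Node e rs => [set t | e = ~~ d /\ [set Node e ts | ts in finducing e rs] t]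
  end.

(** The dichotomy is whether [strip] keeps the root. If a root node disappears, its children
    together strip to one tree, of the class of [r]. *)
Lemma inducing_top d r : no_unary r -> 0%N \notin leaves r ->
  inducing d r = top d r `|` [set Node (~~ d) ts | ts in
    [set ts | finducing (~~ d) [:: r] ts /\ (1 < size ts)%N]].
Proof.
move=> nur r0; apply/seteqP; split=> [[a|e ts]|t].
- case=> _ /=; case: ifP => _; first by move/perm_size.
  move=> /cl_ins[us1 [u [us2 [uE ur _]]]]; left.
  case: us1 uE => [[uE _]|v [|? ?] //]; subst u.
  by rewrite (reorder_leafl ur).
- case; rewrite allowed_node => /and3P[/eqP -> sz okts] /=.
  case: ifP => sz2.
    move=> /cl_ins[us1 [u [us2 [uE ur _]]]]; left.
    case: us1 uE => [|v [|? ?]] //= [uE]; subst u.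
    case: r ur {nur r0} => [i /reorder_leafr//|e' rs /reorder_nodeP[<- p]].
    by split=> //; exists ts.
  by move=> p; right; exists ts.
case: r nur r0 => [i _|e rs /= /andP[szr nurs]] r0.
  case=> [->|[ts [[okts p] sz] <-]].
    (* The label [i] is not 0, so [strip] does not prune this leaf. *)
    by split=> //=; move: r0; rewrite inE eq_sym => /negPf ->.
  split; first by rewrite allowed_node eqxx sz.
  by rewrite /= ifN //; move/perm_size: p; rewrite /= size_map => ->.
case=> [[-> [ts [okts p] <-]]|[ts [[okts p] sz] <-]].
  have sz : (1 < size (flatten (map (@strip bool) ts)))%N.
    by move/perm_size: p; rewrite !size_map => ->.
  split; last by rewrite /= sz /= (proj2 (clP _ _) (reorder_nodes (~~ d) p)).
  rewrite allowed_node eqxx okts /= andbT; apply: leq_trans sz _.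
  by rewrite size_strips; apply: count_size.
split; first by rewrite allowed_node eqxx sz.
by rewrite /= ifN //; move/perm_size: p; rewrite /= size_map => ->.
Qed.

Lemma tgf_inducing d r : no_unary r -> 0%N \notin leaves r ->
  tgf (inducing d r) = tgf (top d r) + tgf (inducing (~~ d) r) * (fps_exp L - 1).
Proof.
move=> nur r0; rewrite -inducing_path // {1}inducing_top // [LHS]gfU //.
- by apply: lfin_sub (@lfin_inducing d r); rewrite inducing_top //; left.
- by apply: lfin_sub (@lfin_inducing d r); rewrite inducing_top //; right.
(* Disjointness for a node: its children strip to [size rs] trees, at least two, in the first set
   and to one in the second. *)
- move=> t; case: r nur r0 => [i _ _ -> []//|e rs /= /andP[szr _] _].
  move=> [-> [ts [_ p] <-]] [us [[_ p'] _] [tsE]]; subst.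
  move/perm_size: p; move/perm_size: p'; rewrite !size_map => -> sz.
  by rewrite -sz in szr.
Qed.

(** * The generating function *)

(** With [E] for [fps_exp L - 1], the recursions give [L_odd = L_even * E] and
    [L_even * (1 - E * E) = 1], so [L_even] is the inverse of the determinant of the system. *)
Lemma parity_system (x y a b : fps) :
  x = a + y * (fps_exp L - 1) -> y = b + x * (fps_exp L - 1) ->
  x = a * L_even + b * L_odd.
Proof.
have := L_even_rec; have := L_odd_rec; set E := fps_exp L - 1 => oE eE xE yE.
transitivity (x * (L_even - L_odd * E)).
  by rewrite {1}eE addrK mulr1.
transitivity (L_even * (x - x * E * E)); first by rewrite oE; ring.
have -> : x - x * E * E = a + b * E by rewrite {1}xE yE; ring.
by rewrite oE; ring.
Qed.

Lemma tgf_top_leaf d i : tgf (top d (Leaf i)) = fps_X.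
Proof. exact: tgf_leaf. Qed.

Lemma tgf_top_node d e rs :
  tgf (top d (Node e rs)) = if e == ~~ d then fgf (finducing e rs) else 0.
Proof.
case: eqP => [eE|neE]; last first.
  apply: fpsP => n /=; rewrite (_ : [set x | _] = set0) ?wsum0 //.
  by apply/seteqP; split=> // t [[/neE]].
rewrite -(tgf_node e (@lfin_finducing e rs)); congr tgf.
by apply/seteqP; split=> [t []|t].
Qed.

(** The product of the theorem without the factor [fps_deriv L], which stands for what lies above
    the root. *)
Definition cotree_gf (t : ptree bool) : fps :=
  fps_exp L ^+ n_internal t * L_bullet ^+ n_leaves t
  * L_odd ^+ n_eq_edges t * L_even ^+ n_neq_edges t.

(** Factor of the edge from a parent decorated [d] to the root of [t]; it is 1 when [t] is a
    leaf. *)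
Definition edge_gf (d : bool) (t : ptree bool) : fps :=
  L_odd ^+ decorated d t * L_even ^+ decorated (~~ d) t.

Lemma cotree_gf_node e rs : cotree_gf (Node e rs) =
  (\prod_(r <- rs) (cotree_gf r * edge_gf e r)) * fps_exp L.
Proof.
suff -> : \prod_(r <- rs) (cotree_gf r * edge_gf e r) =
    fps_exp L ^+ sumn (map (@n_internal bool) rs) * L_bullet ^+ fsize rs
    * L_odd ^+ (count (decorated e) rs + sumn (map n_eq_edges rs))
    * L_even ^+ (count (decorated (~~ e)) rs + sumn (map n_neq_edges rs)).
  by rewrite /cotree_gf /= exprS; ring.
elim: rs => [|r rs IH]; first by rewrite big_nil !expr0 !mulr1.
rewrite big_cons IH /cotree_gf /edge_gf -cat1s fsize_cat {2}/fsize /fleaves /= cats0.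
by rewrite !exprD; ring.
Qed.

Lemma tgf_inducing_top d r : no_unary r -> 0%N \notin leaves r ->
  tgf (inducing d r) = tgf (top d r) * L_even + tgf (top (~~ d) r) * L_odd.
Proof.
move=> nur r0; apply: parity_system; first exact: tgf_inducing.
by have := tgf_inducing (~~ d) nur r0; rewrite negbK.
Qed.

(** For a leaf, [fps_X * (L_even + L_odd)] is [L_bullet]. For a node, only one of the two [top]
    terms survives: the one with [L_odd] if its decoration is [d], the one with [L_even]
    otherwise. *)
Lemma tgf_inducingE d t : no_unary t -> uniq (leaves t) -> 0%N \notin leaves t ->
  tgf (inducing d t) = cotree_gf t * edge_gf d t.
Proof.
elim/ptree_ind_mem: t d => [i|e rs IH] d nu un t0; rewrite tgf_inducing_top //.
  rewrite !tgf_top_leaf /cotree_gf /edge_gf /= !expr0 !mulr1 mul1r expr1.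
  by rewrite -mulrDr -deriv_L.
have B : fgf (finducing e rs) = cotree_gf (Node e rs).
  case/andP: nu => _ nurs; rewrite fgf_finducing // cotree_gf_node; congr (_ * _).
  apply: eq_big_seq => r rrs; apply: IH => //; first exact: (allP nurs).
    case/splitPr: rrs un => s1 s2; rewrite /= map_cat flatten_cat /= uniq_catCA.
    by rewrite cat_uniq => /and3P[].
  apply: contra t0 => r0; rewrite /= -/(fleaves rs) mem_fleaves.
  by apply/hasP; exists r.
rewrite !tgf_top_node B /edge_gf /= negbK.
case: e d {un t0 IH B nu} => -[] /=;
  by rewrite ?mul0r ?add0r ?addr0 ?expr0 ?mulr1 ?mul1r.
Qed.

(** Canonicity and the induced cotree are expressed through the marked tree alone, the form required
    by [wsum_marked]. *)
Lemma marked_strip k (t0 : ptree bool) n (p : ptree bool * k.-tuple nat) :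
  marked k t0 n p <-> [/\ labeled n p.1, uniq p.2, {subset p.2 <= leaves p.1} &
    Defs.canonical (relabel (mark p.2) p.1) /\
    perm_eq (map (@cl bool) (strip (relabel (mark p.2) p.1))) [:: cl t0]].
Proof.
case: p => t I; rewrite canonical_relabel; split.
  move=> [/= lt ct uI sub [u ru ut0]]; split=> //; split=> //.
  by rewrite -restrictE ?(labeled_uniq lt) // ru /= (proj2 (clP _ _) ut0).
move=> [/= lt uI sub [ct]]; rewrite -restrictE ?(labeled_uniq lt) // => p.
split=> //; move: (p) => /perm_size; rewrite size_map /=.
case E: (Defs.restrict I t) p => [|u [|//]] // /cl_ins[us1 [v [us2 [uE vt0 _]]]] _.
exists u => //; case: us1 uE => [[-> _] //|w [|? ?] //].
Qed.

(** For a fixed tuple, the plane representatives of a cotree form a reordering class, of weight 1;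
    [wsum_marked] then trades labels for marks. *)
Lemma M_gf k t0 : M k t0 = tgf [set m | [/\ no_unary m, perm_eq (marks m) (iota 1 k) &
  Defs.canonical m /\ perm_eq (map (@cl bool) (strip m)) [:: cl t0]]].
Proof.
apply: fpsP => n /=.
set S := marked k t0 n; set B := [set m | _ /\ _].
have fS : finite_set S.
  by apply: sub_finite_set (@finite_labeled_tuples _ k n) => p [].
have -> : (card_set [set (\pi_(tree bool) p.1, p.2) | p in S])%:R =
    wsum (fun p : ptree bool * k.-tuple nat => weight p.1) S.
  apply: (@wsum_card _ _ _ (fun p : ptree bool * k.-tuple nat => (cl p.1, p.2))) => //.
  move=> [t I] St; case: (St) => /= lt _ _ _ _.
  rewrite -[RHS](@wsum_reorder _ t); [|by case/andP: lt|exact: labeled_uniq lt].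
  apply: (@wsum_inj _ _ _ _ (fun u => (u, I))) => //.
  - apply: sub_finite_set (@finite_labeled _ n) => u /= ut.
    by rewrite (reorder_labeled n ut).
  - by move=> u v _ _ [].
  - move=> [u J]; split=> /=; first by move=> [_ [/clP ut ->]]; exists u.
    move=> [v vt [<- <-]]; split; last by congr pair; apply/clP.
    move/marked_strip: St => [/= _ uI sub [ct st]]; apply/marked_strip; split=> //=.
    + by rewrite (reorder_labeled n vt).
    + by move=> a /sub; rewrite (perm_mem (reorder_leaves vt)).
    + have vt' := reorder_relabel (mark I) vt; split.
        by rewrite (reorder_canonical vt').1.
      exact: perm_trans (reorder_strip vt') st.
have -> : S = [set p : ptree bool * k.-tuple nat | [/\ labeled n p.1, uniq p.2,
    {subset p.2 <= leaves p.1} & Defs.canonical (relabel (mark p.2) p.1) /\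
    perm_eq (map (@cl bool) (strip (relabel (mark p.2) p.1))) [:: cl t0]]].
  by apply/seteqP; split=> p /marked_strip.
rewrite (@wsum_marked _ k n (fun m => Defs.canonical m /\
  perm_eq (map (@cl bool) (strip m)) [:: cl t0])) mulrC mulKf //.
by rewrite pnatr_eq0 -lt0n fact_gt0.
Qed.

Theorem theorem5p3 (k : nat) (t0 : ptree bool)
    (hk : (2 <= k)%N) (ht0 : labeled k t0) :
  M k t0 = fps_deriv L * fps_exp L ^+ n_internal t0 * L_bullet ^+ k
           * L_odd ^+ n_eq_edges t0 * L_even ^+ n_neq_edges t0.
Proof.
have [nu pt0] := andP ht0.
have ut0 : uniq (leaves t0) := labeled_uniq ht0.
have t00 : 0%N \notin leaves t0 by rewrite (perm_mem pt0) mem_iota.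
have t0k : n_leaves t0 = k := labeled_size ht0.
rewrite M_gf.
(* A virtual parent is placed above the root, with a decoration different from that of the root. *)
have -> : [set m | [/\ no_unary m, perm_eq (marks m) (iota 1 k) &
    Defs.canonical m /\ perm_eq (map (@cl bool) (strip m)) [:: cl t0]]] =
    inducing true t0 `|` inducing false t0.
  apply/seteqP; split=> [t [nut mt [ct st]]|t].
    case td: (decorated true t); [right|left]; split=> //;
      rewrite /allowed nut ct //= ?td //.
    by case: t td {nut mt ct st} => //= -[].
  move=> H; have [d dt] : exists d, inducing d t0 t.
    by case: H; [exists true|exists false].
  case: (dt) => /and3P[nut ct _] st; split=> //.
  exact: perm_trans (inducing_marks dt) pt0.
rewrite [LHS]gfU; last 3 first.
- exact: lfin_inducing.
- exact: lfin_inducing.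
(* Only a single leaf is allowed below both decorations, and it carries at most one mark, against
   [2 <= k]. *)
- move=> [a|e ts] t1 t2.
    have := perm_size (inducing_marks t1); rewrite -/(n_leaves t0) t0k => ka.
    by move: hk; rewrite -ka /marks /=; case: ifP.
  by case: t1 t2 => /and3P[_ _ +] _ [/and3P[_ _ +] _] /=; case: e.
(* The edge to the virtual parent contributes [L_odd] for one decoration and [L_even] for the other,
   whose sum is [fps_deriv L]. *)
rewrite -!/(tgf _) !tgf_inducingE // -mulrDr /cotree_gf t0k /edge_gf deriv_L.
case: t0 {ht0 pt0 ut0 t00} nu t0k => [a _ k1|[] ts _ _] /=.
- by move: hk; rewrite -k1.
- by rewrite !expr0 !expr1 mulr1 mul1r; ring.
- by rewrite !expr0 !expr1 mulr1 mul1r; ring.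
Qed.
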